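(* Let $G_1$ be a finite connected oriented graph with distinguished vertices $a_1,b_1$ such that $d_1(a_1,b_1)>1$ and there exist at least two edge-disjoint paths connecting $a_1$ to $b_1$ in $G_1$. Let $\bar G_\infty=(G_\infty,E_\infty)$ be the Benjamini–Schramm limit of the hierarchical graphs with seed $G_1$. Then, for almost every realization of $\bar G_\infty$, the function $p\mapsto\theta^{\bar G_\infty}(p)$ is continuous on $[0,1]$.
   Context: $G_1=(V_1,\mathcal E_1)$ is a finite connected oriented graph (a finite simple graph with an orientation chosen for each edge), with two distinguished vertices $a_1,b_1$. Orientations are used only to define the replacement operation below; distances, paths and connectivity ignore orientation. $d_1$ is the graph distance in $G_1$. Hierarchical graphs: $G_0$ is a single oriented edge $(a_0,b_0)$. Given $G_k=(V_k,\mathcal E_k)$ with distinguished vertices $a_k,b_k$, $G_{k+1}$ is obtained by replacing each oriented edge $(x,y)\in\mathcal E_k$ by a fresh copy of $G_1$, with $a_1$ identified with $x$ and $b_1$ with $y$; $a_{k+1},b_{k+1}$ are the vertices that were $a_k,b_k$. Benjamini–Schramm limit: let $\mathcal G$ be the space of connected, locally finite edge-rooted graphs (orientations forgotten) up to root-preserving isomorphism, with metric $d(\bar G,\bar G')=\inf\{1/(r+1):\bar G|_r\cong\bar G'|_r\}$, where $\bar G|_r$ is the rooted subgraph induced by vertices within distance $r$ of an endpoint of the root edge. With $E_k$ uniform in $\mathcal E_k$, the random elements $(G_k,E_k)$ converge in distribution in $\mathcal G$; the limit is the random edge-rooted infinite graph $\bar G_\infty=(G_\infty,E_\infty)$. Percolation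 on $\bar G_\infty$: given $\bar G_\infty$, under $\mathbf P_p^{\bar G_\infty}$ each edge of $G_\infty$ is independently open with probability $p$. $\theta^{\bar G_\infty}(p)=\mathbf P_p^{\bar G_\infty}(E_\infty\leftrightarrow\infty)$ is the probability that some endpoint of $E_\infty$ lies in an infinite open cluster. *)

(* Defs.v *)
From HB Require Import structures.
From mathcomp Require Import all_boot all_order all_algebra generic_quotient.
From mathcomp Require Import all_classical all_reals all_analysis measurable_realfun.

Set Implicit Arguments.
Unset Strict Implicit.
Unset Printing Implicit Defensive.

Import Order.TTheory GRing.Theory Num.Theory.
Import numFieldNormedType.Exports.

Local Open Scope classical_set_scope.
Local Open Scope ring_scope.

(** * Walks and graph distance *)

Section walks.
Context {T : eqType}.
Implicit Types (e : rel T) (x y : T) (s : seq T).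

Definition undirected e : rel T := [rel x y | e x y || e y x].

Definition is_walk e x y s := path e x s && (last x s == y).

(* The junk value 0 is only taken when [x] and [y] are not connected. *)
Definition graph_dist e x y : nat :=
  if pselect (exists n, `[< exists2 s, is_walk e x y s & size s = n >])
    is left h then ex_minn h else 0%N.

Definition is_upath e x y s := is_walk e x y s && uniq (x :: s).

Lemma graph_dist_le e x y r : (exists s, is_walk e x y s) ->
  (graph_dist e x y <= r)%N <-> exists2 s, is_walk e x y s & (size s <= r)%N.
Proof.
move=> [s0 s0P]; rewrite /graph_dist; case: pselect => [h|]; last first.
  by case; exists (size s0); apply/asboolP; exists s0.
case: ex_minnP => m /asboolP[s sP sm] mmin; split=> [mr|[t tP tr]].
  by exists s => //; rewrite sm.
by apply: leq_trans tr; apply: mmin; apply/asboolP; exists t.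
Qed.

End walks.

Definition traversed {V : finType} (x : V) (s : seq V) : seq {set V} :=
  pairmap (fun u v => [set u; v]%SET) x s.

Definition two_edge_disjoint_paths (V : finType) (e : rel V) (a b : V) :=
  exists s t, [/\ is_upath e a b s, is_upath e a b t &
                  ~~ has [in traversed a s] (traversed a t)].

(** * Oriented graphs with two terminals, and hierarchical graphs *)

(* Finite connected simple graphs with one orientation per edge; [osrc] and
   [osnk] are the distinguished vertices. *)
Record ograph := OGraph {
  overt :> finType ;
  oarc : rel overt ;
  osrc : overt ;
  osnk : overt ;
  oarc_irr : irreflexive oarc ;
  oarc_asym : forall x y, oarc x y -> ~~ oarc y x ;
  oconn : forall x y, connect (undirected oarc) x y ;
  osrc_neq_osnk : osrc != osnk }.

Arguments oarc {_}.
Arguments osrc {_}.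
Arguments osnk {_}.

Definition uadj (G : ograph) : rel G := undirected oarc.

Arguments uadj : clear implicits.

Definition arcs (G : ograph) := {e : G * G | oarc e.1 e.2}.

HB.instance Definition _ (G : ograph) := Finite.on (arcs G).

Definition atail (G : ograph) (e : arcs G) : G := (sval e).1.

Definition ahead (G : ograph) (e : arcs G) : G := (sval e).2.

Lemma arcP (G : ograph) (e : arcs G) : oarc (atail e) (ahead e).
Proof. exact: svalP e. Qed.

Lemma arc_eq (G : ograph) (e f : arcs G) :
  atail e = atail f -> ahead e = ahead f -> e = f.
Proof.
case: e f => -[a b] ab [[c d] cd]; rewrite /atail /ahead/= => ac bd.
by apply: val_inj => /=; rewrite ac bd.
Qed.

Lemma undirected_sym (T : eqType) (e : rel T) : symmetric (undirected e).
Proof. by move=> x y; rewrite /undirected/= orbC. Qed.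

Lemma connect_undirected_sym (T : finType) (e : rel T) :
  connect_sym (undirected e).
Proof. by apply: sym_connect_sym => x y; exact: undirected_sym. Qed.

Section single_edge.

Let arc : rel bool := [rel x y | ~~ x && y].

Let arc_irr : irreflexive arc. Proof. by case. Qed.

Let arc_asym x y : arc x y -> ~~ arc y x. Proof. by case: x y => [] []. Qed.

Let conn x y : connect (undirected arc) x y.
Proof. by case: x y => [] []; rewrite ?connect0// connect1. Qed.

Definition single_edge : ograph :=
  @OGraph bool arc false true arc_irr arc_asym conn isT.

End single_edge.

Section replacement.
Variables H G : ograph.

Definition inner := {v : H | v \notin [:: osrc; osnk]}.

HB.instance Definition _ := Finite.on inner.

Definition rvert : finType := (G + arcs G * inner)%type.

(* The vertex [v] of the copy of [H] that replaces the arc [e]. *)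
Definition copy_vert (e : arcs G) (v : H) : rvert :=
  if insub v is Some v' then inr (e, v')
  else inl (if v == osrc then atail e else ahead e).

Definition rarc : rel rvert := fun p q => [exists e, exists u, exists v,
  [&& oarc u v, copy_vert e u == p & copy_vert e v == q]].

Let copy_src e : copy_vert e osrc = inl (atail e).
Proof. by rewrite /copy_vert insubN ?eqxx// !inE eqxx. Qed.

Let copy_snk e : copy_vert e osnk = inl (ahead e).
Proof.
rewrite /copy_vert insubN ?inE ?eqxx ?orbT//.
by rewrite eq_sym (negbTE (osrc_neq_osnk H)).
Qed.

Let copy_inner e (v : inner) : copy_vert e (val v) = inr (e, v).
Proof. by rewrite /copy_vert valK. Qed.

Variant copy_spec e v : rvert -> Type :=
  | CopySrc of v = osrc : copy_spec e v (inl (atail e))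
  | CopySnk of v = osnk : copy_spec e v (inl (ahead e))
  | CopyInner (w : inner) of v = val w : copy_spec e v (inr (e, w)).

Let copyP e v : copy_spec e v (copy_vert e v).
Proof.
have [vt|] := boolP (v \notin [:: osrc; osnk]).
  by rewrite -[v]/(val (Sub v vt : inner)) copy_inner; exact: CopyInner.
rewrite negbK !inE; have [->|_ /eqP->] := eqVneq v osrc.
  by move=> _; rewrite copy_src; exact: CopySrc.
by rewrite copy_snk; exact: CopySnk.
Qed.

Let arc_neq (e : arcs G) : atail e != ahead e.
Proof. by apply/eqP => e12; have := arcP e; rewrite e12 oarc_irr. Qed.

Let copy_inj e : injective (copy_vert e).
Proof.
move=> u v; have /eqP n12 := arc_neq e.
case: (copyP e u) => [->|->|w ->]; case: (copyP e v) => [->|->|w' ->] //.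
- by case=> /n12.
- by case=> /esym /n12.
- by case=> ->.
Qed.

Let rarcP (p q : rvert) : reflect (exists e u v,
  [/\ oarc u v, copy_vert e u = p & copy_vert e v = q]) (rarc p q).
Proof.
apply: (iffP existsP) => [[e /existsP[u /existsP[v /and3P[uv /eqP? /eqP?]]]]|].
  by exists e, u, v.
case=> e [u [v [uv <- <-]]]; exists e; apply/existsP; exists u.
by apply/existsP; exists v; rewrite uv !eqxx.
Qed.

Let rarc_irr : irreflexive rarc.
Proof.
move=> p; apply/negbTE/negP => /rarcP[e [u [v [uv <-]]]] /copy_inj vu.
by move: uv; rewrite vu oarc_irr.
Qed.

Let rarc_asym p q : rarc p q -> ~~ rarc q p.
Proof.
case/rarcP => e [u [v [uv <- <-]]]; apply/negP.
case/rarcP => e' [u' [v' [uv' uv'E vu'E]]].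
have [ee'|nee'] := eqVneq e e'.
  move: uv'E vu'E; rewrite -ee' => /copy_inj u'E /copy_inj v'E.
  by move: uv'; rewrite u'E v'E (negbTE (oarc_asym uv)).
have share f f' x y : f != f' -> copy_vert f x = copy_vert f' y ->
    (x = osrc \/ x = osnk) /\ (y = osrc \/ y = osnk).
  move=> ff'; case: (copyP f x) => [->|->|w _]; case: (copyP f' y) => [->|->|w' _] //;
    try by split; [move: isT; tauto | tauto].
  by case=> ff'E; rewrite ff'E eqxx in ff'.
have neq (x y : H) : oarc x y -> x <> y by move=> + xy; rewrite xy oarc_irr.
have eqe : ~ (atail e = atail e' /\ ahead e = ahead e').
  by move=> [e1 e2]; case/eqP: nee'; exact: arc_eq.
have anti : ~ (atail e = ahead e' /\ ahead e = atail e').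
  by move=> [e1 e2]; have := oarc_asym (arcP e); rewrite e1 e2 (arcP e').
have [u'T vT] := share _ _ _ _ (contra_neq esym nee') uv'E.
have [v'T uT] := share _ _ _ _ (contra_neq esym nee') vu'E.
move: (neq _ _ uv) (neq _ _ uv') uv'E vu'E => {uv uv'}.
by move: uT vT u'T v'T => [] -> [] -> [] -> [] -> //;
   rewrite !(copy_src, copy_snk) => _ _ [? ] [?];
   (case: eqe + case: anti).
Qed.

Let copy_connect e u v :
  connect (undirected rarc) (copy_vert e u) (copy_vert e v).
Proof.
have /connectP[s + ->] := oconn u v.
elim: s u => [|w s IH] u /=; first by rewrite connect0.
case/andP => uw /IH; apply: connect_trans; apply: connect1.
by case/orP: uw => uw; apply/orP; [left|right]; apply/rarcP;
  [exists e, u, w | exists e, w, u].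
Qed.

Let inl_connect x y : connect (undirected rarc) (inl x) (inl y).
Proof.
have arc_c a b (ab : oarc a b) : connect (undirected rarc) (inl a) (inl b).
  have := copy_connect (exist _ (a, b) ab : arcs G) osrc osnk.
  by rewrite copy_src copy_snk.
have /connectP[s + ->] := oconn x y.
elim: s x => [|w s IH] x /=; first by rewrite connect0.
case/andP => /orP[] xw /IH; apply: connect_trans; first exact: arc_c.
by rewrite connect_undirected_sym; exact: arc_c.
Qed.

Let rconn p q : connect (undirected rarc) p q.
Proof.
have toinl r : exists x, connect (undirected rarc) r (inl x).
  case: r => [x|[e w]]; first by exists x; rewrite connect0.
  by exists (atail e); rewrite -copy_src -copy_inner; exact: copy_connect.
have [x px] := toinl p; have [y qy] := toinl q.
apply: (connect_trans px); apply: (connect_trans (inl_connect x y)).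
by rewrite connect_undirected_sym.
Qed.

Let rsrc_neq_rsnk : (inl osrc : rvert) != inl osnk.
Proof. by apply: contra (osrc_neq_osnk G) => /eqP[->]. Qed.

Definition replace_arcs : ograph :=
  @OGraph rvert rarc (inl osrc) (inl osnk)
    rarc_irr rarc_asym rconn rsrc_neq_rsnk.

End replacement.

Fixpoint hierarchical (G1 : ograph) (k : nat) : ograph :=
  if k is k'.+1 then replace_arcs G1 (hierarchical G1 k') else single_edge.

(** * The space of edge-rooted graphs *)

(* Connected locally finite graphs are countable, so vertices are taken in [nat]. *)
Record egraph := EGraph {
  gvert : set nat ;
  gadj : rel nat ;
  groot : nat * nat ;
  gadj_vert : forall x y, gadj x y -> gvert x ;
  gadj_sym : symmetric gadj ;
  gadj_irr : irreflexive gadj ;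
  gconn : forall x y, gvert x -> gvert y -> exists s, is_walk gadj x y s ;
  gfin : forall x, finite_set [set y | gadj x y] ;
  groot_adj : gadj groot.1 groot.2 }.

HB.instance Definition _ := gen_eqMixin egraph.
HB.instance Definition _ := gen_choiceMixin egraph.

Section rooted_finite_graph.
Variables (G : ograph) (e : arcs G).

Let vert : set nat := [set pickle v | v in [set: G]].

Let adj : rel nat := fun m n => [exists x : G, exists y : G,
  [&& uadj _ x y, pickle x == m & pickle y == n]].

Let pickle_injG : injective (@pickle G) := pcan_inj pickleK.

Let adjP m n : reflect (exists x y : G,
  [/\ uadj _ x y, pickle x = m & pickle y = n]) (adj m n).
Proof.
apply: (iffP existsP) => [[x /existsP[y /and3P[? /eqP ? /eqP ?]]]|].
  by exists x, y.
by case=> x [y [? <- <-]]; exists x; apply/existsP; exists y; apply/and3P.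
Qed.

Let adjE (x y : G) : adj (pickle x) (pickle y) = uadj _ x y.
Proof.
apply/adjP/idP => [[x' [y' [xy /pickle_injG <- /pickle_injG <-]]]//|xy].
by exists x, y.
Qed.

Let adj_vert m n : adj m n -> vert m.
Proof. by move/adjP => [x [y [_ <- _]]]; exists x. Qed.

Let adj_sym : symmetric adj.
Proof.
move=> m n; apply/adjP/adjP => -[x [y [xy <- <-]]]; exists y, x; split => //;
  by rewrite /uadj undirected_sym.
Qed.

Let adj_irr : irreflexive adj.
Proof.
move=> m; apply/negbTE/negP => /adjP[x [y [+ <- /pickle_injG yx]]].
by rewrite yx /uadj/undirected/= oarc_irr.
Qed.

Let conn m n : vert m -> vert n -> exists s, is_walk adj m n s.
Proof.
move=> [x _ <-] [y _ <-]; have /connectP[s + ->] := oconn x y.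
elim: s x => [|z s IH] x /=; first by exists [::]; rewrite /is_walk/= eqxx.
case/andP=> xz /IH[t /andP[zt tl]]; exists (pickle z :: t).
by rewrite /is_walk/= adjE /uadj xz zt.
Qed.

Let fin m : finite_set [set n | adj m n].
Proof.
apply: (@sub_finite_set _ _ (vert)); last exact/finite_image/finite_finset.
by move=> n /=; rewrite adj_sym => /adj_vert.
Qed.

Let root_adj : adj (pickle (atail e), pickle (ahead e)).1
                   (pickle (atail e), pickle (ahead e)).2.
Proof. by rewrite adjE /uadj/undirected/= arcP. Qed.

(* [G] rooted at [e], orientations forgotten. *)
Definition rooted : egraph :=
  @EGraph vert adj (pickle (atail e), pickle (ahead e))
    adj_vert adj_sym adj_irr conn fin root_adj.

End rooted_finite_graph.

Definition egraph0 : egraph :=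
  rooted (exist _ (false, true) isT : arcs single_edge).

HB.instance Definition _ := isPointed.Build egraph egraph0.

(* Isomorphism between the subgraphs induced by [A] and [B]; the root is an
   unordered edge. *)
Definition induced_iso (g h : egraph) (A B : set nat) (f : nat -> nat) :=
  [/\ set_bij A B f,
      forall x y, A x -> A y -> gadj h (f x) (f y) = gadj g x y &
      (f (groot g).1 = (groot h).1 /\ f (groot g).2 = (groot h).2) \/
      (f (groot g).1 = (groot h).2 /\ f (groot g).2 = (groot h).1)].

Definition egraph_iso g h := exists f, induced_iso g h (gvert g) (gvert h) f.

Definition root_ball (g : egraph) (r : nat) : set nat :=
  [set v | gvert g v /\
    ((graph_dist (gadj g) (groot g).1 v <= r)%N \/
     (graph_dist (gadj g) (groot g).2 v <= r)%N)].

Definition ball_iso (r : nat) g h :=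
  exists f, induced_iso g h (root_ball g r) (root_ball h r) f.

Definition root_dist (R : realType) (g h : egraph) : R :=
  inf [set r.+1%:R^-1 | r in [set r | ball_iso r g h]].

Section isomorphism_theory.
Implicit Types (g h k : egraph) (A B C : set nat).

Let root_end g : set nat := [set u | u = (groot g).1 \/ u = (groot g).2].

Let gvert_end g u : root_end g u -> gvert g u.
Proof.
case=> ->; first exact: gadj_vert (groot_adj g).
by have := groot_adj g; rewrite gadj_sym => /gadj_vert.
Qed.

Let path_vert g u s : gvert g u -> path (gadj g) u s -> gvert g (last u s).
Proof.
elim: s u => //= v s IH u gu /andP[uv]; apply: IH.
by apply: (@gadj_vert _ _ u); rewrite gadj_sym.
Qed.

Let root_ballP g r v : root_ball g r v <-> exists u s,
  [/\ root_end g u, path (gadj g) u s, last u s = v & (size s <= r)%N].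
Proof.
have r1 : gvert g (groot g).1 by apply: gvert_end; left.
have r2 : gvert g (groot g).2 by apply: gvert_end; right.
split=> [[gv [/(graph_dist_le _ (gconn r1 gv))|/(graph_dist_le _ (gconn r2 gv))]]|].
- by move=> [s /andP[sp /eqP sv] sr]; exists (groot g).1, s; split => //; left.
- by move=> [s /andP[sp /eqP sv] sr]; exists (groot g).2, s; split => //; right.
move=> [u [s [ru us uv sr]]].
have gv : gvert g v by rewrite -uv; apply: path_vert us; exact: gvert_end.
split => //; case: ru => uE; [left|right]; subst u.
- by apply/(graph_dist_le _ (gconn r1 gv)); exists s => //; rewrite /is_walk us uv eqxx.
- by apply/(graph_dist_le _ (gconn r2 gv)); exists s => //; rewrite /is_walk us uv eqxx.
Qed.

Let root_ball_vert g r : root_ball g r `<=` gvert g.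
Proof. by move=> v []. Qed.

Let root_ball_le g r s : (r <= s)%N -> root_ball g r `<=` root_ball g s.
Proof.
move=> rs v /root_ballP[u [t [? ? ? tr]]]; apply/root_ballP; exists u, t.
by split => //; apply: leq_trans rs.
Qed.

Let root_end_ball g r u : root_end g u -> root_ball g r u.
Proof. by move=> gu; apply/root_ballP; exists u, [::]. Qed.

Let root_ball_cover g v : gvert g v -> exists r, root_ball g r v.
Proof.
move=> gv; have g1 : gvert g (groot g).1 by apply: gvert_end; left.
have [s /andP[sp /eqP sv]] := gconn g1 gv.
by exists (size s); apply/root_ballP; exists (groot g).1, s; split => //; left.
Qed.

Let root_ball_finite g r : finite_set (root_ball g r).
Proof.
elim: r => [|r IH].
  apply: (@sub_finite_set _ _ [set (groot g).1; (groot g).2]); last first.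
    by rewrite finite_setU; split; exact: finite_set1.
  by move=> v /root_ballP[u [[|? ?] [? _ <- //]]].
apply: (@sub_finite_set _ _ (root_ball g r `|`
    \bigcup_(u in root_ball g r) [set v | gadj g u v])); last first.
  rewrite finite_setU; split => //; apply: bigcup_finite => // u _.
  exact: gfin.
move=> v /root_ballP[u [s [gu]]].
case: (lastP s) => [|t w].
  by move=> _ <- _; left; exact: root_end_ball.
rewrite rcons_path last_rcons size_rcons ltnS => /andP[ut tw] <- tr.
by right; exists (last u t) => //; apply/root_ballP; exists u, t.
Qed.

Let iso_end g h A B f u : induced_iso g h A B f -> root_end g u ->
  root_end h (f u).
Proof. by move=> [_ _ [[f1 f2]|[f1 f2]]] [->|->]; rewrite ?f1 ?f2;
  by [left|right]. Qed.

Let iso_ball g h A B f r : root_ball g r `<=` A -> induced_iso g h A B f ->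
  forall v, root_ball g r v -> root_ball h r (f v).
Proof.
move=> gA fi v /root_ballP[u [s [gu us <- sr]]].
apply/root_ballP; exists (f u), (map f s); split.
- exact: iso_end fi gu.
- have [_ fadj _] := fi; rewrite path_map.
  elim/last_ind: s us sr => //= s w IH; rewrite !rcons_path size_rcons.
  move=> /andP[us sw] sr; rewrite IH//=; last exact: ltnW.
  rewrite fadj//; apply: gA; apply/root_ballP.
    by exists u, s; split => //; exact: ltnW.
  exists u, (rcons s w); rewrite size_rcons last_rcons; split => //.
  by rewrite rcons_path us.
- by rewrite last_map.
- by rewrite size_map.
Qed.

Let iso_refl g A : induced_iso g g A A id.
Proof.
split; [split=> //|by []|by left].
by move=> x Ax; exists x.
Qed.

Let iso_trans g h k A B C f f' : root_end h `<=` B ->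
  induced_iso g h A B f -> induced_iso h k B C f' ->
  induced_iso g k A C (f' \o f).
Proof.
move=> hB [[ff fi fs] fa fr] [[f'f f'i f's] f'a f'r]; split; first split.
- by move=> x Ax; apply: f'f; exact: ff.
- move=> x y; rewrite !inE => Ax Ay /= /f'i; rewrite !inE => e.
  by apply: fi; rewrite ?inE//; apply: e; exact: ff.
- by move=> z /f's[y /fs[x Ax <-] <-]; exists x.
- by move=> x y Ax Ay /=; rewrite f'a ?fa//; exact: ff.
- by move: fr f'r => /= [[-> ->]|[-> ->]] [[-> ->]|[-> ->]]; [left|right|right|left].
Qed.

Let iso_inv g h A B f : root_end g `<=` A -> induced_iso g h A B f ->
  exists2 f', induced_iso h g B A f' & forall x, A x -> f' (f x) = x.
Proof.
move=> gA [[ff fi fs] fa fr].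
have /choice[f' f'P] : forall y, exists x, B y -> A x /\ f x = y.
  move=> y; have [/fs[x Ax xy]|nBy] := pselect (B y); first by exists x.
  by exists 0%N.
have f'K x : A x -> f' (f x) = x.
  move=> Ax; have [Af'x] := f'P _ (ff _ Ax).
  by apply: fi; rewrite inE.
exists f' => //; split; first split.
- by move=> y /f'P[].
- move=> y z; rewrite !inE => By Bz yz.
  by rewrite -(f'P _ By).2 -(f'P _ Bz).2 yz.
- by move=> x Ax; exists (f x); [exact: ff|exact: f'K].
- move=> y z By Bz; rewrite -fa; [|exact: (f'P _ _).1..].
  by rewrite (f'P _ By).2 (f'P _ Bz).2.
- have A1 : A (groot g).1 by apply: gA; left.
  have A2 : A (groot g).2 by apply: gA; right.
  by case: fr => -[<- <-]; rewrite !f'K//; [left|right].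
Qed.

Let iso_restrict g h A B f r : root_ball g r `<=` A -> root_ball h r `<=` B ->
  induced_iso g h A B f -> induced_iso g h (root_ball g r) (root_ball h r) f.
Proof.
move=> gA hB fi.
have [f' f'i f'K] := iso_inv (subset_trans (@root_end_ball g r) gA) fi.
have fball := iso_ball gA fi; have f'ball := iso_ball hB f'i.
case: (fi) => -[ff fin fs] fa fr; split => //; first split => //.
- by move=> x y; rewrite !inE => /gA Ax /gA Ay; apply: fin; rewrite inE.
- move=> y yh; have [x Ax fx] := fs _ (hB _ yh); exists x => //.
  by rewrite -(f'K _ Ax) fx; exact: f'ball.
- by move=> x y /gA Ax /gA Ay; exact: fa.
Qed.

Lemma egraph_iso_refl g : egraph_iso g g.
Proof. by exists id; exact: iso_refl. Qed.

Lemma egraph_iso_sym g h : egraph_iso g h -> egraph_iso h g.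
Proof. by case=> f /(iso_inv (@gvert_end g))[f' ? _]; exists f'. Qed.

Lemma egraph_iso_trans h g k :
  egraph_iso g h -> egraph_iso h k -> egraph_iso g k.
Proof.
by move=> [f fi] [f' f'i]; exists (f' \o f); apply: iso_trans fi f'i; exact: gvert_end.
Qed.

Lemma ball_iso_refl r g : ball_iso r g g.
Proof. by exists id; exact: iso_refl. Qed.

Lemma ball_iso_sym r g h : ball_iso r g h -> ball_iso r h g.
Proof. by case=> f /(iso_inv (@root_end_ball g r))[f' ? _]; exists f'. Qed.

Lemma ball_iso_trans r h g k :
  ball_iso r g h -> ball_iso r h k -> ball_iso r g k.
Proof.
by move=> [f fi] [f' f'i]; exists (f' \o f); apply: iso_trans fi f'i; exact: root_end_ball.
Qed.

Lemma ball_iso_le r s g h : (r <= s)%N -> ball_iso s g h -> ball_iso r g h.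
Proof.
move=> rs [f fi]; exists f; apply: iso_restrict fi; exact: root_ball_le.
Qed.

Lemma egraph_iso_ball r g h : egraph_iso g h -> ball_iso r g h.
Proof.
by case=> f fi; exists f; apply: iso_restrict fi; exact: root_ball_vert.
Qed.

Lemma ball_iso0 g h : ball_iso 0 g h.
Proof.
have neq k : (groot k).1 <> (groot k).2.
  by move=> e; have := groot_adj k; rewrite e gadj_irr.
have b0 k v : root_ball k 0 v <-> root_end k v.
  split=> [/root_ballP[u [[|? ?] [? _ <- //]]]|]; exact: root_end_ball.
pose f n := if n == (groot g).1 then (groot h).1 else (groot h).2.
have f1 : f (groot g).1 = (groot h).1 by rewrite /f eqxx.
have f2 : f (groot g).2 = (groot h).2.
  by rewrite /f; case: eqP => // /esym/neq.
exists f; split; last by left.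
- split.
  + by move=> x /b0[]->; apply/b0; [left|right].
  + move=> x y; rewrite !inE => /b0[]-> /b0[]->; rewrite ?f1 ?f2 => // e;
      by case: (neq h).
  + move=> y /b0[]->; [exists (groot g).1|exists (groot g).2] => //; apply/b0.
    * by left.
    * by right.
- have g21 : gadj g (groot g).2 (groot g).1 by rewrite gadj_sym groot_adj.
  have h21 : gadj h (groot h).2 (groot h).1 by rewrite gadj_sym groot_adj.
  by move=> x y /b0[]-> /b0[]->; rewrite ?f1 ?f2 ?gadj_irr ?groot_adj ?g21 ?h21.
Qed.

Let ultra_pick (U : set_system nat) (f : nat -> nat) (B : set nat) :
  UltraFilter U -> finite_set B -> U [set r | B (f r)] ->
  exists2 w, B w & U [set r | f r = w].
Proof.
move=> UU /finite_seqP[s ->]; elim: s => [|w s IH].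
  by move=> U0; have [r] := filter_ex U0.
move=> Uws; have [Uw|Uw] := in_ultra_setVsetC [set r | f r = w] UU.
  by exists w => //=; rewrite mem_head.
have [|v vs Uv] := IH.
  apply: filterS (filterI Uws Uw) => r [/=]; rewrite inE => /orP[/eqP//|].
  by [].
by exists v => //=; rewrite inE; apply/orP; right.
Qed.

(* Compactness argument; a limit of ball isomorphisms along an ultrafilter. *)
Lemma ball_iso_all g h : (forall r, ball_iso r g h) -> egraph_iso g h.
Proof.
move=> /choice[f fP].
have [U [UU ooU]] := @ultraFilterLemma nat \oo _.
have Uge n (P : set nat) : (forall r, (n <= r)%N -> P r) -> U P.
  by move=> nP; apply: ooU; exists n.
have fball r n v : (n <= r)%N -> root_ball g n v -> root_ball h n (f r v).
  by move=> nr; exact: (iso_ball (root_ball_le nr) (fP r)).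
have /choice[F FP] : forall v, exists w, gvert g v ->
    gvert h w /\ U [set r | f r v = w].
  move=> v; have [gv|] := pselect (gvert g v); last by exists 0%N.
  have [n vn] := root_ball_cover gv.
  have [|w wn Uw] := @ultra_pick U (fun r => f r v) _ UU (root_ball_finite h n).
    by apply: (Uge n) => r nr; exact: fball.
  by exists w => _; split => //; exact: root_ball_vert wn.
have FU v : gvert g v -> U [set r | f r v = F v] by move=> /FP[].
have Uball v : gvert g v -> U [set r | root_ball g r v].
  move=> /root_ball_cover[n vn]; apply: (Uge n) => r nr.
  exact: root_ball_le vn.
have g1 : gvert g (groot g).1 by apply: gvert_end; left.
have g2 : gvert g (groot g).2 by apply: gvert_end; right.
exists F; split; first split.
- by move=> v /FP[].
- move=> u v; rewrite !inE => gu gv uv.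
  have [r [[/= ru rv] [bu bv]]] := filter_ex
    (filterI (filterI (FU _ gu) (FU _ gv)) (filterI (Uball _ gu) (Uball _ gv))).
  have [[_ finj _] _ _] := fP r.
  by apply: finj; rewrite ?inE//= ru rv.
- move=> w hw; have [n wn] := root_ball_cover hw.
  have /choice[p pP] : forall r, exists v, (n <= r)%N ->
      root_ball g n v /\ f r v = w.
    move=> r; have [nr|] := boolP (n <= r)%N; last by exists 0%N.
    have [[_ _ fs] _ _] := iso_restrict (root_ball_le nr) (root_ball_le nr) (fP r).
    by have [v ? ?] := fs _ wn; exists v.
  have [|v vn Uv] := @ultra_pick U p _ UU (root_ball_finite g n).
    by apply: (Uge n) => r /pP[].
  have gv := root_ball_vert vn; exists v => //.
  have Un : U [set r | (n <= r)%N] by exact: (Uge n).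
  have [r [[/= rF rv] nr]] := filter_ex (filterI (filterI (FU _ gv) Uv) Un).
  by rewrite -rF -rv; have [] := pP _ nr.
- move=> u v gu gv.
  have [r [[/= ru rv] [bu bv]]] := filter_ex
    (filterI (filterI (FU _ gu) (FU _ gv)) (filterI (Uball _ gu) (Uball _ gv))).
  by have [_ fa _] := fP r; rewrite -ru -rv fa.
- have [r [/= r1 r2]] := filter_ex (filterI (FU _ g1) (FU _ g2)).
  by rewrite -r1 -r2; have [] := fP r.
Qed.

End isomorphism_theory.

Section root_dist_theory.
Context {R : realType}.
Implicit Types g h k : egraph.

Let S g h : set R := [set r.+1%:R^-1 | r in [set r | ball_iso r g h]].

Let S_inf g h : has_inf (S g h).
Proof.
split; first by exists 1; exists 0%N; rewrite ?invr1//; exact: ball_iso0.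
by exists 0 => _ [r _ <-]; rewrite invr_ge0.
Qed.

Lemma root_dist_ge0 g h : 0 <= root_dist R g h.
Proof.
apply: lb_le_inf; first by case: (S_inf g h).
by move=> _ [r _ <-]; rewrite invr_ge0.
Qed.

Lemma root_dist_lt g h (e : R) :
  root_dist R g h < e <-> exists2 r, ball_iso r g h & r.+1%:R^-1 < e.
Proof.
split=> [|[r rP]].
  by move/(inf_lt (S_inf g h).1) => [_ [r rP <-] re]; exists r.
by apply: le_lt_trans; apply: ge_inf; [exact: (S_inf g h).2|exists r].
Qed.

Lemma eq_root_dist g h g' h' : (forall r, ball_iso r g h <-> ball_iso r g' h') ->
  root_dist R g h = root_dist R g' h'.
Proof.
move=> e; congr inf; apply/seteqP; split => _ [r /e rP <-]; by exists r.
Qed.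

Lemma root_dist_sym g h : root_dist R g h = root_dist R h g.
Proof. by apply: eq_root_dist => r; split; exact: ball_iso_sym. Qed.

Lemma root_dist_eq0 g h : root_dist R g h = 0 <-> egraph_iso g h.
Proof.
split=> [d0|gh].
  apply: ball_iso_all => n.
  have : root_dist R g h < n.+1%:R^-1 by rewrite d0 invr_gt0.
  move=> /root_dist_lt[r rP]; rewrite ltf_pV2 ?posrE// ltr_nat ltnS => nr.
  exact: ball_iso_le (ltnW nr) rP.
apply/eqP; rewrite eq_le root_dist_ge0 andbT; apply/ler_addgt0Pl => e e0.
rewrite addr0 ltW//; apply/root_dist_lt.
have [n ne] := ltr_add_invr e0; exists n; first exact: egraph_iso_ball.
by rewrite add0r in ne.
Qed.

Lemma root_dist_triangle h g k :
  root_dist R g k <= root_dist R g h + root_dist R h k.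
Proof.
rewrite leNgt; apply/negP => lt.
have : root_dist R g h < root_dist R g k.
  by apply: le_lt_trans lt; rewrite lerDl root_dist_ge0.
move=> /root_dist_lt[r ghr lr].
have : root_dist R h k < root_dist R g k.
  by apply: le_lt_trans lt; rewrite lerDr root_dist_ge0.
move=> /root_dist_lt[s hks ls].
suff : root_dist R g k < root_dist R g k by rewrite ltxx.
apply/root_dist_lt; exists (minn r s); last by case: leqP.
apply: (@ball_iso_trans _ h).
- exact: ball_iso_le (geq_minl r s) ghr.
- exact: ball_iso_le (geq_minr r s) hks.
Qed.

End root_dist_theory.

Definition egraph_isob : rel egraph := fun g h => `[< egraph_iso g h >].

Lemma egraph_isob_refl : reflexive egraph_isob.
Proof. by move=> g; apply/asboolP; exact: egraph_iso_refl. Qed.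

Lemma egraph_isob_sym : symmetric egraph_isob.
Proof.
by move=> g h; apply/asboolP/asboolP; exact: egraph_iso_sym.
Qed.

Lemma egraph_isob_trans : transitive egraph_isob.
Proof.
move=> h g k /asboolP gh /asboolP hk; apply/asboolP.
exact: egraph_iso_trans hk.
Qed.

Canonical egraph_equiv :=
  EquivRel egraph_isob egraph_isob_refl egraph_isob_sym egraph_isob_trans.

Local Open Scope quotient_scope.
(* The field [R] only serves to fix the codomain of the metric. *)
Definition bsgraph (R : realType) := {eq_quot egraph_isob}%qT.

Section bsgraph_structure.
Variable R : realType.

HB.instance Definition _ := Choice.on (bsgraph R).
HB.instance Definition _ := EqQuotient.on (bsgraph R).
HB.instance Definition _ := isPointed.Build (bsgraph R) (\pi_(bsgraph R) point)%qT.

Definition bsdist (x y : bsgraph R) : R := root_dist R (repr x) (repr y).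

Lemma repr_iso (g : egraph) : egraph_iso (repr (\pi_(bsgraph R) g)%qT) g.
Proof.
have : (repr (\pi_(bsgraph R) g)%qT == g %[mod bsgraph R])%qT by rewrite reprK.
by rewrite eqmodE => /asboolP.
Qed.

Lemma bsdist_pi (g h : egraph) :
  bsdist (\pi_(bsgraph R) g)%qT (\pi_(bsgraph R) h)%qT = root_dist R g h.
Proof.
apply: eq_root_dist => r.
have ig := egraph_iso_ball r (repr_iso g).
have ih := egraph_iso_ball r (repr_iso h).
split=> gh.
  exact: ball_iso_trans (ball_iso_trans (ball_iso_sym ig) gh) ih.
exact: ball_iso_trans (ball_iso_trans ig gh) (ball_iso_sym ih).
Qed.

Let bsdistxx x : bsdist x x = 0.
Proof. by apply/root_dist_eq0; exact: egraph_iso_refl. Qed.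

Let bsdist_positivity x y : bsdist x y = 0 -> x = y.
Proof.
move=> /root_dist_eq0 xy; rewrite -[x]reprK -[y]reprK.
by apply/eqP; rewrite eqmodE; apply/asboolP.
Qed.

HB.instance Definition _ := isMetric.Build R (bsgraph R)
  bsdistxx bsdist_positivity
  (fun x y => root_dist_sym (repr x) (repr y))
  (fun y x z => root_dist_triangle (repr y) (repr x) (repr z)).

End bsgraph_structure.

HB.instance Definition _ (R : realType) := Measurable.copy (bsgraph R)
  (g_sigma_algebraType (@open (bsgraph R))).

(** * Bernoulli percolation *)

Definition config (I : Type) := I -> bool.

HB.instance Definition _ (I : Type) := Pointed.copy (config I) (I -> bool).

HB.instance Definition _ (I : Type) := Measurable.copy (config I)
  (g_sigma_algebraType [set [set w : config I | w i] | i in [set: I]]).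

(* The coordinates are independent and [true] with probability [p]. *)
Definition is_bernoulli_product (R : realType) (I : eqType) (p : R)
    (mu : probability (config I) R) :=
  forall (s : seq I) (b : I -> bool), uniq s ->
  mu [set w | {in s, forall i, w i = b i}] =
  (\prod_(i <- s) (if b i then p else 1 - p))%:E.

Section bernoulli_product_exists.
Variables (R : realType) (p : R).

Let unit_ico : set R := `[0, 1[%classic.

Let unit_ico_measurable : measurable unit_ico.
Proof. exact: measurable_itv. Qed.

Let U := mrestr (@lebesgue_measure R) unit_ico_measurable.

Let U_setT : U setT = 1%:E.
Proof.
rewrite /U /mrestr setTI lebesgue_measure_itv/= lte_fin ltr01.
by rewrite -EFinD subr0.
Qed.

HB.instance Definition _ := Measure.on U.

HB.instance Definition _ := Measure_isProbability.Build _ _ _ U U_setT.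

Let shift (x : R) := if x < p then x / p else (x - p) / (1 - p).

Let bit k (x : R) := iter k shift x < p.

Let shift_measurable : measurable_fun [set: R] shift.
Proof.
apply: measurable_fun_if => //=.
- exact: measurable_fun_ltr.
- apply: measurable_funTS; exact: measurable_funM.
- apply: measurable_funTS; apply: measurable_funM => //.
  exact: measurable_funB.
Qed.

Let bit_measurable k : measurable_fun [set: R] (bit k).
Proof.
apply: measurable_fun_ltr => //; elim: k => [|k IH]; first exact: measurable_id.
rewrite [X in measurable_fun _ X](_ : _ = shift \o iter k shift)//; exact: measurableT_comp.
Qed.

Hypotheses (p_ge0 : 0 <= p) (p_le1 : p <= 1).

Let wt (b : bool) : R := if b then p else 1 - p.

Let word_itv (w : seq bool) : exists c : R,
  [/\ 0 <= c, 0 <= \prod_(b <- w) wt b, c + \prod_(b <- w) wt b <= 1 &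
      forall x, (0 <= x < 1 /\ forall k, (k < size w)%N -> bit k x = nth false w k)
        <-> c <= x < c + \prod_(b <- w) wt b].
Proof.
have q_ge0 : 0 <= 1 - p by rewrite subr_ge0.
elim: w => [|b w [c [c0 l0 cl cP]]].
  exists 0; rewrite big_nil add0r; split => // x; split => [[]//|x01]; split => //.
rewrite big_cons; set l := \prod_(b <- w) wt b in l0 cl cP *.
have wtl : 0 <= wt b * l by rewrite mulr_ge0// /wt; case: b.
have step x : (0 <= x < 1 /\
      forall k, (k < (size w).+1)%N -> bit k x = nth false (b :: w) k) <->
    [/\ 0 <= x < 1, (x < p) = b & 0 <= shift x < 1 ->
       c <= shift x < c + l].
  split=> [[x01 xb]|[x01 xp xs]].
    split => //; first exact: (xb 0%N).
    move=> s01; apply/cP; split => // k kw.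
    by have := xb k.+1 kw; rewrite /bit iterSr.
  split => //; case => [|k]; first by [].
  rewrite ltnS /= => kw; rewrite /bit iterSr.
  have s01 : 0 <= shift x < 1.
    rewrite /shift; case: ifPn => xp'.
      have p0 : 0 < p by apply: le_lt_trans xp'; case/andP: x01.
      rewrite divr_ge0//=; last by case/andP: x01.
      by rewrite ltr_pdivrMr// mul1r.
    have q0 : 0 < 1 - p.
      by rewrite subr_gt0; case/andP: x01 => _; apply: le_lt_trans; rewrite leNgt.
    rewrite divr_ge0//= ?subr_ge0 ?leNgt//.
    by rewrite ltr_pdivrMr// mul1r ltrD2r; case/andP: x01.
  by have [_] := (cP (shift x)).2 (xs s01); exact.
have c1 : c <= 1 by apply: le_trans cl; rewrite lerDl.
case: b wtl step => /= wtl step.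
  exists (p * c); split => //; first exact: mulr_ge0.
    by rewrite -mulrDr; apply: mulr_ile1; rewrite ?addr_ge0.
  move=> x; apply: (iff_trans (step x)); rewrite -mulrDr.
  split=> [[x01 xp]|/andP[x1 x2]].
    have p0 : 0 < p by apply: le_lt_trans xp; case/andP: x01.
    have s01 : 0 <= x / p < 1.
      by rewrite divr_ge0//= ?ltr_pdivrMr ?mul1r//; case/andP: x01.
    rewrite /shift xp => /(_ s01).
    by rewrite ler_pdivlMr// ltr_pdivrMr// !(mulrC p).
  have x0 : 0 <= x by apply: le_trans x1; exact: mulr_ge0.
  have xp : x < p by apply: lt_le_trans x2 _; rewrite ler_piMr.
  have p0 : 0 < p by exact: le_lt_trans xp.
  split => //; first by rewrite x0 (lt_le_trans xp).
  by move=> _; rewrite /shift xp ler_pdivlMr// ltr_pdivrMr// !(mulrC _ p) x1.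
exists (p + (1 - p) * c).
have pE : p + (1 - p) * c + (1 - p) * l = p + (1 - p) * (c + l).
  by rewrite mulrDr addrA.
have pl1 : p + (1 - p) * (c + l) <= 1.
  by rewrite -lerBrDl ler_piMr.
rewrite pE; split => //; first by rewrite addr_ge0// mulr_ge0.
move=> x; apply: (iff_trans (step x)).
split=> [[x01 xp]|/andP[x1 x2]].
  have px : p <= x by rewrite leNgt xp.
  have q0 : 0 < 1 - p.
    by rewrite subr_gt0; apply: le_lt_trans px _; case/andP: x01.
  have s01 : 0 <= (x - p) / (1 - p) < 1.
    rewrite divr_ge0 ?subr_ge0//= ltr_pdivrMr// mul1r ltrD2r.
    by case/andP: x01.
  rewrite /shift xp => /(_ s01).
  by rewrite ler_pdivlMr// ltr_pdivrMr// lerBrDl ltrBlDl !(mulrC (1 - p)).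
have px : p <= x by apply: le_trans x1; rewrite lerDl mulr_ge0.
have xlt1 : x < 1 by exact: lt_le_trans pl1.
have xp : (x < p) = false by rewrite ltNge px.
have q0 : 0 < 1 - p by rewrite subr_gt0; exact: le_lt_trans xlt1.
split => //; first by rewrite xlt1 andbT (le_trans p_ge0).
move=> _; rewrite /shift xp ler_pdivlMr// ltr_pdivrMr// lerBrDl ltrBlDl.
by rewrite !(mulrC _ (1 - p)) x1.
Qed.

Let cyl (s : seq nat) (c : nat -> bool) : set R :=
  [set x | {in s, forall k, bit k x = c k}].

Let cyl_measurable s c : measurable (cyl s c).
Proof.
elim: s => [|k s IH].
  rewrite (_ : cyl _ _ = setT); first exact: measurableT.
  by apply/seteqP; split.
rewrite (_ : cyl _ _ = bit k @^-1` [set c k] `&` cyl s c).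
  apply: measurableI => //; rewrite -[X in measurable X]setTI.
  exact: bit_measurable.
apply/seteqP; split=> [x xs|x [xk xs] j].
  by split=> [|j js]; apply: xs; rewrite inE ?eqxx// js orbT.
by rewrite inE => /predU1P[->|/xs].
Qed.

Let U_cyl_iota n c : U (cyl (iota 0 n) c) = (\prod_(k <- iota 0 n) wt (c k))%:E.
Proof.
have [a [a0 l0 al aP]] := word_itv (mkseq c n).
rewrite /U /mrestr (_ : _ `&` _ = `[a, a + \prod_(b <- mkseq c n) wt b[%classic).
  rewrite lebesgue_measure_itv/= lte_fin ltrDl -EFinD addrAC subrr add0r.
  by move: l0; rewrite big_map le_eqVlt => /predU1P[<-|->]//; rewrite ltxx.
apply/seteqP; split=> x /=; rewrite /unit_ico/= !in_itv/=.
  move=> [xs x01]; apply/aP; split => // k; rewrite size_mkseq => kn.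
  by rewrite nth_mkseq//; apply: xs; rewrite mem_iota.
move=> /aP[x01 xs]; split => // k; rewrite mem_iota/= add0n => kn.
by rewrite xs ?size_mkseq// nth_mkseq.
Qed.

Let U_cyl_drop k s : k \notin s ->
  (forall c, U (cyl (k :: s) c) = (\prod_(i <- k :: s) wt (c i))%:E) ->
  forall c, U (cyl s c) = (\prod_(i <- s) wt (c i))%:E.
Proof.
move=> ks H c; pose d b := fun i => if i == k then b else c i.
have -> : cyl s c = cyl (k :: s) (d true) `|` cyl (k :: s) (d false).
  apply/seteqP; split=> [x xs|x xs j js].
    have [xk|xk] := boolP (bit k x); [left|right] => j; rewrite inE /d;
      by case: eqVneq => [->|_ /= /xs]//; rewrite (negbTE xk).
  have jk : (j == k) = false by apply: contraNF ks => /eqP <-.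
  by case: xs => /(_ j); rewrite /d jk inE js orbT; exact.
transitivity (U (cyl (k :: s) (d true)) + U (cyl (k :: s) (d false)))%E.
  apply: measureU; [exact: cyl_measurable|exact: cyl_measurable|].
  apply/seteqP; split=> // x [/(_ k) + /(_ k)].
  by rewrite inE eqxx /d eqxx => /(_ isT) -> /(_ isT).
rewrite !H -EFinD !big_cons /d eqxx/=.
have E b : \prod_(j <- s) wt (if j == k then b else c j) = \prod_(j <- s) wt (c j).
  apply: eq_big_seq => j js; case: eqP => // jk.
  by rewrite -jk js in ks.
by rewrite !E -mulrDl addrCA subrr addr0 mul1r.
Qed.

Let U_cyl s c : uniq s -> U (cyl s c) = (\prod_(k <- s) wt (c k))%:E.
Proof.
move=> us; pose n := (\max_(k <- s) k).+1.
pose t := [seq k <- iota 0 n | k \notin s].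
have ts : perm_eq (t ++ s) (iota 0 n).
  apply: uniq_perm; rewrite ?iota_uniq//.
    rewrite cat_uniq filter_uniq ?iota_uniq// us andbT/=.
    by apply/hasPn => k ks; rewrite mem_filter ks.
  move=> k; rewrite mem_cat mem_filter.
  have [ks|//] := boolP (k \in s); last by rewrite orbF.
  by rewrite orbT mem_iota/= add0n ltnS leq_bigmax_seq.
have : uniq (t ++ s) by rewrite (perm_uniq ts) iota_uniq.
have : forall c, U (cyl (t ++ s) c) = (\prod_(k <- t ++ s) wt (c k))%:E.
  move=> c'; rewrite (perm_big _ ts) -U_cyl_iota; congr (U _).
  by apply/seteqP; split=> x xs k; [rewrite -(perm_mem ts)|rewrite (perm_mem ts)];
    exact: xs.
elim: t {ts} => [|k t IH] H /=; first by move=> _; exact: H.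
by move=> /andP[kt uts]; apply: IH => //; exact: (U_cyl_drop kt).
Qed.

Variable I : countType.

Let coins (x : measurableTypeR R) : config I := fun i => bit (pickle i) x.

Let coins_measurable : measurable_fun [set: measurableTypeR R] coins.
Proof.
apply: (@measurability _ _ _ _ _ _ [set [set w : config I | w i] | i in [set: I]]) => //.
move=> _ [_ [i _ <-] <-]; exact: bit_measurable.
Qed.

HB.instance Definition _ :=
  isMeasurableFun.Build _ _ _ _ coins coins_measurable.

Lemma bernoulli_product_exists_itv :
  exists mu : probability (config I) R, is_bernoulli_product p mu.
Proof.
exists (distribution U coins) => s b us.
pose c k := if unpickle k is Some i then b i else false.
rewrite /distribution/= /pushforward.
have -> : coins @^-1` [set w | {in s, forall i, w i = b i}] = cyl (map pickle s) c.
  apply/seteqP; split=> x /= xs.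
    by move=> _ /mapP[i si ->]; rewrite /c pickleK -xs.
  by move=> i si; rewrite /coins xs ?map_f// /c pickleK.
have ups : uniq (map pickle s) by rewrite map_inj_uniq//; exact: pcan_inj pickleK.
rewrite U_cyl//.
by rewrite big_map /c; congr EFin; apply: eq_bigr => i _; rewrite pickleK.
Qed.

End bernoulli_product_exists.

Lemma bernoulli_product_exists (R : realType) (I : countType) (p : R) :
  exists mu : probability (config I) R,
    0 <= p <= 1 -> is_bernoulli_product p mu.
Proof.
have [/andP[p0 p1]|_] := boolP (0 <= p <= 1).
  by have [mu muP] := bernoulli_product_exists_itv p0 p1 I; exists mu.
by have [mu _] := bernoulli_product_exists_itv (lexx 0) (@ler01 R) I; exists mu.
Qed.

(* Unspecified for [p] outside [0, 1]. *)
Definition bernoulli_product (R : realType) (I : countType) (p : R) :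
  probability (config I) R := sval (cid (bernoulli_product_exists I p)).

Lemma bernoulli_productP (R : realType) (I : countType) (p : R) :
  0 <= p <= 1 -> is_bernoulli_product p (bernoulli_product I p).
Proof. by rewrite /bernoulli_product; case: cid. Qed.

(* An unordered edge is represented with its smaller endpoint first. *)
Definition edge (g : egraph) :=
  {e : nat * nat | (e.1 < e.2)%N && gadj g e.1 e.2}.

HB.instance Definition _ (g : egraph) := Countable.on (edge g).

Section clusters.
Variable g : egraph.
Implicit Type w : config (edge g).

Definition open_adj w : rel nat := fun x y =>
  if insub (minn x y, maxn x y) is Some e then w e else false.

Definition open_cluster w (x : nat) : set nat :=
  [set y | exists s, is_walk (open_adj w) x y s].

Definition root_percolates : set (config (edge g)) :=
  [set w | infinite_set (open_cluster w (groot g).1) \/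
           infinite_set (open_cluster w (groot g).2)].

Let open_adj_measurable x y : measurable [set w | open_adj w x y].
Proof.
rewrite /open_adj; case: insub => [e|].
  by apply: sub_sigma_algebra; exists e.
have -> : [set w : config (edge g) | false] = set0 by apply/seteqP; split.
exact: measurable0.
Qed.

Let walk_measurable x y s : measurable [set w | is_walk (open_adj w) x y s].
Proof.
elim: s x => [|z s IH] x.
  have [xy|xy] := boolP (x == y).
    by rewrite (_ : [set _ | _] = setT)//; apply/seteqP; split=> // w _.
  rewrite (_ : [set _ | _] = set0)//; apply/seteqP; split=> // w.
  by rewrite /= /is_walk /= (negbTE xy).
rewrite (_ : [set _ | _] =
  [set w | open_adj w x z] `&` [set w | is_walk (open_adj w) z y s]).
  exact: measurableI.
apply/seteqP; split=> w; rewrite /is_walk/= -andbA => /andP //.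
Qed.

Let infinite_natP (A : set nat) :
  infinite_set A <-> forall n, exists m, A (n + m)%N.
Proof.
split=> [Ainf n|Aunb].
  have /infinite_setN0[m [Am /= mn]] := infinite_setD Ainf (finite_II n).
  by exists (m - n)%N; rewrite subnKC// leqNgt; apply/negP.
move=> /finite_seqP[s sA]; have [m] := Aunb (\max_(k <- s) k).+1.
rewrite sA /= => ms; have := @leq_bigmax_seq _ s xpredT id _ ms isT.
by rewrite leqNgt addSn ltnS leq_addr.
Qed.

Let infinite_cluster_measurable x :
  measurable [set w | infinite_set (open_cluster w x)].
Proof.
have -> : [set w | infinite_set (open_cluster w x)] =
    \bigcap_n \bigcup_m \bigcup_(s : seq nat)
      [set w | is_walk (open_adj w) x (n + m)%N s].
  apply/seteqP; split=> w /=.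
    by move=> /infinite_natP wx n _; have [m [s ?]] := wx n; exists m => //; exists s.
  move=> wx; apply/infinite_natP => n.
  by have [m _ [s _ ?]] := wx n I; exists m, s.
apply: bigcapT_measurable => n; apply: bigcupT_measurable => m.
by apply: countable_bigcupT_measurable => // s; exact: walk_measurable.
Qed.

Lemma root_percolates_measurable : measurable root_percolates.
Proof. by apply: measurableU; exact: infinite_cluster_measurable. Qed.

End clusters.

Arguments root_percolates : clear implicits.

(* The value does not depend on the representative of the isomorphism class. *)
Definition theta (R : realType) (x : bsgraph R) (p : R) : R :=
  fine (bernoulli_product (edge (repr x)) p (root_percolates (repr x))).

(** * Benjamini-Schramm limit *)

Section bs_limit.
Context {R : realType}.

(* Expectation of [f (G, E)] for [E] uniform among the arcs of [G] *)
Definition root_mean (G : ograph) (f : bsgraph R -> R) : R :=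
  #|{: arcs G}|%:R^-1 * \sum_(e : arcs G) f (\pi_(bsgraph R) (rooted e))%qT.

Definition is_bs_limit (G1 : ograph) d (T : measurableType d)
    (P : probability T R) (X : {mfun T >-> bsgraph R}) :=
  forall f : bsgraph R -> R, continuous f -> bounded_fun f ->
  (root_mean (hierarchical G1 k) f)%:E @[k --> \oo] --> 'E_P[f \o X]%E.

End bs_limit.

(* Main.v *)
Require Import Defs.
From mathcomp Require Import all_boot all_order all_algebra generic_quotient.
From mathcomp Require Import all_classical all_reals all_analysis lra.

Set Implicit Arguments.
Unset Strict Implicit.
Unset Printing Implicit Defensive.

Import Order.TTheory GRing.Theory Num.Theory.
Import numFieldNormedType.Exports.

Local Open Scope classical_set_scope.
Local Open Scope ring_scope.


(** Write m for the number of arcs of the seed, f(p) for the probability that the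
  percolated seed connects its two terminals, and f^k for the iterates of f. The
  k-th hierarchical graph connects its terminals with probability f^k(p)
  ([cross_probS]), because it is the seed with each arc replaced by an independent
  copy of the previous graph. Two edge-disjoint paths give 1 - f(p) = O((1-p)^2), hence
  f(p) > p just below 1, and there is a largest s < 1 with f(s) <= s
  ([seed_cross_threshold]). Below s the iterates of f stay below s; above s they
  tend to 1, and 1 - f^k(p) is eventually halved at each step, uniformly on
  [p0, 1] for p0 > s.

  The root edge of the limit lies in a nested family of blocks, copies of the
  k-th hierarchical graph that touch the rest of the graph only at two
  terminals. The position of the root in a block is a word of k arcs of the
  seed. Let q_k(p) be the probability that, inside the block, the root is
  connected to a terminal; it is a polynomial in p. An infinite cluster has to
  leave the block, so theta <= q_k ([edge_theta_le]). Passing from a block to the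
  next one can only lower q, and lowers it by at most m (1 - f^k(p)), since the root
  stays connected to the new terminals when all the m sub-blocks connect their
  terminals ([reach_probS_le], [reach_probS_ge]).

  Call a pair of consecutive digits of the word sheltered if closing all the
  other sub-blocks of these two levels separates the root from the terminals of
  the outer block. Each such pair costs q a constant factor when p <= s
  ([reach_prob_sheltered]). As the terminals of the seed are not adjacent, a
  sheltered pair exists ([sheltered_exists]), and almost every limit graph has
  blocks with arbitrarily many of them ([almost_surely_sheltered]).

  This gives continuity. For p <= s, theta is squeezed between 0 and the
  polynomials q, which are as small as one likes at p
  ([edge_theta_continuous_sub]). For p > s, theta is the limit of the q's, because a block of level k that connects its terminals
  forces the cluster of the root, once it reaches a terminal, to have more than k
  vertices; and the q's are within a uniformly small distance of the finitely
  many polynomials of a fixed level ([edge_theta_continuous_super]).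

  The limit is reached only through the convergence of the means of continuous
  functions: the existence of a block with a given number of sheltered pairs
  depends on a ball around the root, so it is a clopen event, and its
  probability is bounded below by its frequency in the finite graphs
  ([bs_limit_local]). *)

(** * Connectivity in a percolated oriented graph *)

Section open_graph.
Variable G : ograph.
Implicit Types (c : arcs G -> bool) (e : arcs G) (C : pred G) (x y : G).

Definition open_rel c : rel G := fun x y => [exists e, c e &&
  ((atail e == x) && (ahead e == y) || (atail e == y) && (ahead e == x))].

Lemma open_relP c x y : reflect
  (exists2 e, c e & (atail e = x /\ ahead e = y) \/ (atail e = y /\ ahead e = x))
  (open_rel c x y).
Proof.
apply: (iffP existsP) => [[e /andP[ce /orP[]/andP[/eqP<- /eqP<-]]]|[e ce exy]].
- by exists e => //; left.
- by exists e => //; right.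
by exists e; rewrite ce; case: exy => -[-> ->]; rewrite !eqxx ?orbT.
Qed.

Lemma open_rel_arc c e : c e -> open_rel c (atail e) (ahead e).
Proof. by move=> ce; apply/open_relP; exists e => //; left. Qed.

Lemma open_connect_sym c : connect_sym (open_rel c).
Proof.
apply: sym_connect_sym => x y.
by apply/open_relP/open_relP => -[e ce [] exy]; exists e; auto.
Qed.

(** Cuts rather than walks: a set closed under open arcs certifies that two
  vertices are not connected, and closed sets glue well along a replacement. *)
Definition closed_under c C := forall e, c e -> C (atail e) = C (ahead e).

Lemma closed_under_connect c C x y :
  closed_under c C -> connect (open_rel c) x y -> C x = C y.
Proof.
move=> cC /connectP[s + ->]; elim: s x => //= z s IH x /andP[+ /IH <-].
by move=> /open_relP[e /cC + [] [<- <-]].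
Qed.

Definition crosses c := connect (open_rel c) osrc osnk.

(** [S] tells which of the two ends of [e] a root hidden behind the arc [e] is
  already connected to. *)
Definition reached c e (S : bool * bool) : pred G := fun x =>
  S.1 && connect (open_rel c) (atail e) x ||
  S.2 && connect (open_rel c) (ahead e) x.

Lemma connect_closed c x : closed_under c (connect (open_rel c) x).
Proof.
move=> e /open_rel_arc/connect1 h.
by apply: same_connect_r; [exact: open_connect_sym|].
Qed.

Lemma reached_closed c e S : closed_under c (reached c e S).
Proof. by move=> f cf; rewrite /reached !(connect_closed _ cf). Qed.

Definition terminals c e S := (reached c e S osrc, reached c e S osnk).

End open_graph.

(** * Replacing every arc by a copy of a seed *)

Section copies.
Variables H G : ograph.
Implicit Types (e : arcs G) (u v : H).

Lemma copy_src e : copy_vert e (@osrc H) = inl (atail e).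
Proof. by rewrite /copy_vert insubN ?eqxx// !inE eqxx. Qed.

Lemma copy_snk e : copy_vert e (@osnk H) = inl (ahead e).
Proof.
rewrite /copy_vert insubN ?inE ?eqxx ?orbT//.
by rewrite eq_sym (negbTE (osrc_neq_osnk H)).
Qed.

Lemma copy_inner e (w : inner H) : copy_vert e (val w) = inr (e, w).
Proof. by rewrite /copy_vert valK. Qed.

Variant copy_view e v : rvert H G -> Type :=
  | ViewSrc of v = osrc : copy_view e v (inl (atail e))
  | ViewSnk of v = osnk : copy_view e v (inl (ahead e))
  | ViewInner (w : inner H) of v = val w : copy_view e v (inr (e, w)).

Lemma copyP e v : copy_view e v (copy_vert e v).
Proof.
have [vt|] := boolP (v \notin [:: osrc; osnk]).
  by rewrite -[v]/(val (Sub v vt : inner H)) copy_inner; exact: ViewInner.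
rewrite negbK !inE; have [->|_ /eqP->] := eqVneq v osrc.
  by move=> _; rewrite copy_src; exact: ViewSrc.
by rewrite copy_snk; exact: ViewSnk.
Qed.

Lemma arc_ends_neq (K : ograph) (e : arcs K) : atail e != ahead e.
Proof. by apply/eqP => e12; have := arcP e; rewrite e12 oarc_irr. Qed.

Lemma copy_inj e : injective (@copy_vert H G e).
Proof.
move=> u v; have /eqP n12 := arc_ends_neq e.
case: (copyP e u) => [->|->|w ->]; case: (copyP e v) => [->|->|w' ->] //.
- by case=> /n12.
- by case=> /esym /n12.
- by case=> ->.
Qed.

Lemma sub_arc_subproof e (a : arcs H) :
  @oarc (replace_arcs H G) (copy_vert e (atail a)) (copy_vert e (ahead a)).
Proof.
apply/existsP; exists e; apply/existsP; exists (atail a); apply/existsP.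
by exists (ahead a); rewrite arcP !eqxx.
Qed.

Definition sub_arc e (a : arcs H) : arcs (replace_arcs H G) :=
  exist _ (copy_vert e (atail a), copy_vert e (ahead a)) (sub_arc_subproof e a).

Lemma sub_arc_surj (E : arcs (replace_arcs H G)) :
  exists e a, E = sub_arc e a.
Proof.
case: E => -[p q] /= pq.
have /existsP[e /existsP[u /existsP[v /and3P[uv /eqP up /eqP vq]]]] := pq.
by exists e, (exist _ (u, v) uv); apply: val_inj; rewrite /= -up -vq.
Qed.

Hypothesis far : ~~ uadj H osrc osnk.

(** An arc of a seed with non-adjacent terminals has an inner end, which tells
  the copy it belongs to; so arcs of different copies are different. *)
Lemma arc_inner (a : arcs H) :
  (exists w : inner H, atail a = val w) \/ (exists w : inner H, ahead a = val w).
Proof.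
have [at_|] := boolP (atail a \notin [:: osrc; osnk]).
  by left; exists (exist (fun v : H => v \notin [:: osrc; osnk]) (atail a) at_).
have [ah|] := boolP (ahead a \notin [:: osrc; osnk]).
  by right; exists (exist (fun v : H => v \notin [:: osrc; osnk]) (ahead a) ah).
rewrite !negbK !inE => ah at_; case/negP: far.
have := arcP a; rewrite /uadj/undirected/=.
case/pred2P: ah => ->; case/pred2P: at_ => -> h;
  by move: h; rewrite ?oarc_irr // => ->; rewrite ?orbT.
Qed.

Lemma sub_arc_inj e e' (a a' : arcs H) :
  sub_arc e a = sub_arc e' a' -> e = e' /\ a = a'.
Proof.
move=> [ea ha].
have ee' : e = e'.
  have [[w aw]|[w aw]] := arc_inner a.
    by move: ea; rewrite aw copy_inner; case: (copyP e' _) => // ? _ [].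
  by move: ha; rewrite aw copy_inner; case: (copyP e' _) => // ? _ [].
subst e'; split => //.
by apply: arc_eq; [exact: copy_inj ea|exact: copy_inj ha].
Qed.

End copies.

Section coarse.
Variables H G : ograph.
Implicit Types (c : arcs (replace_arcs H G) -> bool) (e : arcs G).

(** An arc counts as open when its copy of the seed connects the two terminals. *)
Definition coarse c : arcs G -> bool := fun e => crosses (fun a => c (sub_arc e a)).

(** A cut of the coarse graph refines to a cut of the replaced graph: in the copy
  of [e], add to the prescribed set [D e] the components of those terminals
  that lie in [C]. Closedness of [C] makes this consistent at the terminals, since
  a component containing both of them means that [e] is open in the coarse graph. *)
Lemma closed_refine c (C : pred G) (D : arcs G -> pred H) :
  closed_under (coarse c) C ->
  (forall e, closed_under (fun a => c (sub_arc e a)) (D e)) ->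
  (forall e, D e osrc -> C (atail e)) -> (forall e, D e osnk -> C (ahead e)) ->
  exists K : pred (replace_arcs H G),
    [/\ closed_under c K, forall x, K (inl x) = C x &
        forall e v, D e v -> K (copy_vert e v)].
Proof.
move=> clC clD Ds Dt.
pose r e := connect (open_rel (fun a => c (sub_arc e a))).
pose P e (v : H) := [|| D e v, C (atail e) && r e osrc v | C (ahead e) && r e osnk v].
pose K (q : rvert H G) := match q with inl x => C x | inr (e, w) => P e (val w) end.
have cross e : r e osrc osnk -> C (atail e) = C (ahead e) by exact: clC.
have rC e u v : r e u v = r e v u by exact: open_connect_sym.
have KP e v : K (copy_vert e v) = P e v.
  case: copyP => [->|->|w ->] //=; rewrite /P.
  - apply/idP/or3P => [Ce|[/Ds//|/andP[]//|/andP[Ch]]].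
      by apply: Or32; rewrite Ce /r connect0.
    by rewrite rC => /cross->.
  - apply/idP/or3P => [Ce|[/Dt//|/andP[Ct]|/andP[]//]].
      by apply: Or33; rewrite Ce /r connect0.
    by move=> /cross <-.
exists K; split => // [E|e v Dv]; last by rewrite KP /P Dv.
have [e [a ->]] := sub_arc_surj E => cE.
rewrite /atail/ahead/= !KP /P.
by rewrite (clD e _ cE) /r !(@connect_closed _ (fun a => c (sub_arc e a)) _ _ cE).
Qed.

Lemma copy_connect c e u v :
  connect (open_rel (fun a => c (sub_arc e a))) u v ->
  connect (open_rel c) (copy_vert e u : replace_arcs H G) (copy_vert e v).
Proof.
move=> uv.
have := @closed_under_connect _ (fun a => c (sub_arc e a))
  (fun v => connect (open_rel c) (copy_vert e u : replace_arcs H G) (copy_vert e v)) u v.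
move=> /(_ _ uv) <- //.
by move=> a ca; apply: (@connect_closed _ c _ (sub_arc e a)).
Qed.

Lemma inl_connect_coarse c (x y : G) :
  connect (open_rel c) (inl x : replace_arcs H G) (inl y) =
  connect (open_rel (coarse c)) x y.
Proof.
apply/idP/idP => [xy|xy].
  have [|//|//|//|K [clK KC _]] :=
    @closed_refine c (connect (open_rel (coarse c)) x) (fun _ _ => false).
    exact: connect_closed.
  by rewrite -KC -(closed_under_connect clK xy) KC connect0.
have := @closed_under_connect _ (coarse c)
  (fun v => connect (open_rel c) (inl x : replace_arcs H G) (inl v)) x y.
move=> /(_ _ xy) <- // e ce.
have /(@copy_connect c e osrc osnk) := ce.
rewrite copy_src copy_snk => st.
by apply: same_connect_r => //; exact: open_connect_sym.
Qed.

(** The root arc is [a] inside the copy of [e]: only the terminals of that copy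
  reached by the root matter for the rest of the graph. *)
Lemma inl_reached_coarse c e (a : arcs H) S (x : G) :
  reached c (sub_arc e a) S (inl x) =
  reached (coarse c) e (terminals (fun a => c (sub_arc e a)) a S) x.
Proof.
set S' := terminals _ _ _; set ce := fun a => c (sub_arc e a).
apply/idP/idP => [xy|].
  have [||||K [clK KC KD]] := @closed_refine c (reached (coarse c) e S')
    (fun e' v => (e' == e) && reached ce a S v).
  - exact: reached_closed.
  - by move=> e' a' ca'; case: eqP => // e'e; subst e'; exact: reached_closed ca'.
  - by move=> _ /andP[/eqP-> h]; rewrite /reached /S' /= h connect0.
  - by move=> _ /andP[/eqP-> h]; rewrite /reached /S' /= h connect0 orbT.
  rewrite -KC; move: xy => /orP[]/andP[Si /(closed_under_connect clK) <-].
    by apply: KD; rewrite eqxx /= /reached Si connect0.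
  by apply: KD; rewrite eqxx /= /reached Si connect0 orbT.
have step (t : H) y : reached ce a S t -> copy_vert e t = inl y ->
    connect (open_rel (coarse c)) y x -> reached c (sub_arc e a) S (inl x).
  rewrite -inl_connect_coarse => + tE yx.
  by move=> /orP[]/andP[Si /copy_connect]; rewrite tE => h;
    apply/orP; [left|right]; rewrite Si; apply: connect_trans h yx.
by move=> /orP[]/andP[]; [move=> /step/(_ (copy_src H e))|move=> /step/(_ (copy_snk H e))];
  exact.
Qed.

End coarse.

(** * Arcs of the hierarchical graphs as words *)

Section words.
Variables (G1 : ograph) (a0 : arcs G1).
Local Notation A := (arcs G1).
Local Notation hier := (hierarchical G1).
Implicit Types (w : seq A -> bool) (r : seq A) (S : bool * bool) (a : A).

Definition the_arc : arcs single_edge := exist _ (false, true) isT.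

(** Words list the innermost digit first: the head of [r] is the arc of the seed
  chosen in the last replacement. Missing digits default to [a0]. *)
Fixpoint arc_of k r : arcs (hier k) :=
  match k return arcs (hier k) with
  | k'.+1 => sub_arc (arc_of k' (behead r)) (head a0 r)
  | 0 => the_arc
  end.

(** Connection of the terminals, computed from the innermost copies outwards. *)
Fixpoint cross_up k w : bool :=
  if k is k'.+1 then cross_up k' (fun r => crosses (fun a => w (a :: r)))
  else w [::].

(** The terminals reached by the root at position [r], computed in the same order;
  [S] is the status of the root at the ends of the arc [r]. *)
Fixpoint root_up k r S w : bool * bool :=
  if k is k'.+1 then
    root_up k' (behead r) (terminals (fun a => w (a :: behead r)) (head a0 r) S)
      (fun r => crosses (fun a => w (a :: r)))
  else S.

Lemma the_arcE (e : arcs single_edge) : e = the_arc.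
Proof.
have : ~~ (sval e).1 && (sval e).2 by exact: arcP e.
move=> /andP[/negbTE e1 e2]; apply: arc_eq; first exact: e1.
exact: e2.
Qed.

Lemma single_edge_connect (c : arcs single_edge -> bool) x y :
  connect (open_rel c) x y = (x == y) || c the_arc.
Proof.
have [<-|xy] := eqVneq x y; first by rewrite connect0.
have [ce|ce] := boolP (c the_arc).
  apply/connect1/open_relP; exists the_arc => //.
  by move: x y xy => [] [] // _; [right|left].
apply/negP => xcy.
have := @closed_under_connect _ c (pred1 x) x y.
have clx : closed_under c (pred1 x).
  by move=> e; rewrite (the_arcE e) (negbTE ce).
by move=> /(_ clx xcy); rewrite /= eqxx eq_sym (negbTE xy).
Qed.

Lemma crosses_hier k (c : arcs (hier k) -> bool) :
  crosses c = cross_up k (c \o arc_of k).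
Proof.
elim: k c => [|k IH] c; first by rewrite /crosses single_edge_connect.
exact: (etrans (inl_connect_coarse c osrc osnk) (IH _)).
Qed.

Lemma terminals_saturated (K : ograph) (c : arcs K -> bool) (e : arcs K) S :
  crosses c -> (terminals c e S).1 = (terminals c e S).2.
Proof. exact: closed_under_connect (@reached_closed _ c e S). Qed.

(** The hypothesis says that [S] takes the root arc itself into account. *)
Lemma root_hier k (c : arcs (hier k) -> bool) r S :
  (c (arc_of k r) -> S.1 = S.2) ->
  terminals c (arc_of k r) S = root_up k r S (c \o arc_of k).
Proof.
elim: k c r S => [|k IH] c r S satS.
  rewrite /terminals /reached !single_edge_connect/=.
  case: S satS => s1 s2 /=; case: (c the_arc) => [/(_ isT) ->|_];
    by rewrite ?andbT ?andbF ?orbF ?orbb.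
rewrite /terminals/= !inl_reached_coarse; apply: (IH (coarse c)).
exact: terminals_saturated.
Qed.

(** The graphs are built by replacing innermost arcs, whereas independence is
  between the outermost sub-blocks; this lemma and the next one exchange the two
  readings of a word. *)
Lemma cross_up_top k w :
  cross_up k.+1 w = crosses (fun a => cross_up k (fun r => w (rcons r a))).
Proof.
elim: k w => [//|k IH] w; rewrite -[LHS]/(cross_up k.+1 _) IH; congr crosses.
Qed.

Lemma root_up_top k r a S w : size r = k ->
  root_up k.+1 (rcons r a) S w =
  terminals (fun b => cross_up k (fun r => w (rcons r b))) a
    (root_up k r S (fun r => w (rcons r a))).
Proof.
elim: k r S w => [|k IH] [|b r] S w // [rk].
rewrite -[LHS]/(root_up k.+1 (rcons r a) _ _).
by rewrite IH.
Qed.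

(** Configurations on the arcs of the [k]-th graph, outermost digit first, so that
  a random configuration is a family of independent ones indexed by [A]. *)
Fixpoint cfg k : finType := if k is k'.+1 then {ffun A -> cfg k'} else bool.

Fixpoint tree k w : cfg k :=
  match k return cfg k with
  | k'.+1 => [ffun a => tree k' (fun r => w (rcons r a))]
  | 0 => w [::]
  end.

Fixpoint cross k : cfg k -> bool :=
  match k return cfg k -> bool with
  | k'.+1 => fun t : {ffun A -> cfg k'} => crosses (fun a => cross (t a))
  | 0 => id
  end.

(** Here [r] lists the outermost digit first. *)
Fixpoint root_ends k r : cfg k -> bool * bool :=
  match k return cfg k -> bool * bool with
  | k'.+1 => fun t : {ffun A -> cfg k'} =>
     terminals (fun a => cross (t a)) (head a0 r)
       (root_ends (behead r) (t (head a0 r)))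
  | 0 => fun=> (true, true)
  end.

Lemma cross_tree k w : cross (tree k w) = cross_up k w.
Proof.
elim: k w => [//|k IH] w; rewrite cross_up_top /=; congr crosses.
by apply/funext => a; rewrite ffunE IH.
Qed.

Lemma root_tree k r w : size r = k ->
  root_ends (rev r) (tree k w) = root_up k r (true, true) w.
Proof.
elim: k r w => [|k IH] r w; first by [].
case: (lastP r) => // r' a; rewrite size_rcons => -[rk].
rewrite root_up_top// rev_rcons/= ffunE IH//; congr terminals.
by apply/funext => b; rewrite ffunE cross_tree.
Qed.

Fixpoint wsum (M : nmodType) n (F : seq A -> M) : M :=
  if n is n'.+1 then \sum_(a : A) wsum n' (fun r => F (a :: r)) else F [::].

Lemma eq_wsum (M : nmodType) n (F F' : seq A -> M) :
  (forall r, size r = n -> F r = F' r) -> wsum n F = wsum n F'.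
Proof.
elim: n F F' => [|n IH] F F' FF' /=; first exact: FF'.
by apply: eq_bigr => a _; apply: IH => r rn; rewrite FF'//= rn.
Qed.

Lemma wsum_sum (M : nmodType) n (F : A -> seq A -> M) :
  \sum_(a : A) wsum n (F a) = wsum n (fun r => \sum_a F a r).
Proof.
elim: n F => [//|n IH] F /=; rewrite exchange_big; apply: eq_bigr => a _.
exact: IH.
Qed.

Lemma wsum_top (M : nmodType) n (F : seq A -> M) :
  wsum n.+1 F = \sum_(a : A) wsum n (fun r => F (rcons r a)).
Proof.
elim: n F => [//|n IH] F; rewrite -[LHS]/(\sum_a wsum n.+1 _).
under eq_bigr do rewrite IH.
by rewrite exchange_big; apply: eq_bigr.
Qed.

Lemma wsum_cst (M : nmodType) n (x : M) : wsum n (fun=> x) = x *+ (#|{: A}| ^ n)%N.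
Proof.
elim: n => [|n IH] /=; first by rewrite expn0.
by rewrite IH sumr_const expnSr mulrnA.
Qed.

Lemma wsum_take (M : nmodType) n m (F : seq A -> M) :
  wsum (n + m) (fun r => F (take n r)) = wsum n F *+ (#|{: A}| ^ m)%N.
Proof.
elim: n F => [|n IH] F /=.
  by rewrite -wsum_cst; apply: eq_wsum => r _; rewrite take0.
rewrite -sumrMnl; apply: eq_bigr => a _; exact: (IH (fun r => F (a :: r))).
Qed.

Lemma ler_wsum (K : numDomainType) n (F F' : seq A -> K) :
  (forall r, size r = n -> F r <= F' r) -> wsum n F <= wsum n F'.
Proof.
elim: n F F' => [|n IH] F F' FF' /=; first exact: FF'.
by apply: ler_sum => a _; apply: IH => r rn; apply: FF'; rewrite /= rn.
Qed.

Lemma wsumB (M : zmodType) n (F F' : seq A -> M) :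
  wsum n (fun r => F r - F' r) = wsum n F - wsum n F'.
Proof.
by elim: n F F' => [//|n IH] F F' /=; rewrite -sumrB; apply: eq_bigr => a _.
Qed.

Lemma wsumZ (K : pzRingType) n (F : seq A -> K) x :
  wsum n (fun r => x * F r) = x * wsum n F.
Proof.
by elim: n F => [//|n IH] F /=; rewrite mulr_sumr; apply: eq_bigr => a _.
Qed.

Hypothesis far : ~~ uadj G1 osrc osnk.

Lemma sum_arcs_hier (M : nmodType) n (F : arcs (hier n) -> M) :
  \sum_E F E = wsum n (F \o arc_of n).
Proof.
elim: n F => [|n IH] F /=.
  by rewrite (big_pred1 the_arc)// => e; apply/esym/eqP; exact: the_arcE.
rewrite wsum_sum -(IH (fun e => \sum_a F (sub_arc e a))) pair_big/=.
rewrite (reindex (fun p : arcs (hier n) * A => sub_arc p.1 p.2))//=.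
apply: onW_bij; have /choice[g gP] (E : arcs (hier n.+1)) :
    exists p, sub_arc p.1 p.2 = E :> arcs (hier n.+1).
  by have [e [a ->]] := sub_arc_surj E; exists (e, a).
exists g => [[e a]|E]; last exact: gP.
have /(sub_arc_inj far) := gP (sub_arc e a).
by case: (g _) => e' a' /= [-> ->].
Qed.

Lemma card_arcs_hier n : #|{: arcs (hier n)}| = (#|{: A}| ^ n)%N.
Proof.
by rewrite -sum1_card sum_arcs_hier /comp wsum_cst natn.
Qed.

End words.
(** * Blocks around the root of an infinite graph *)

Lemma connect_step (K : finType) (e : rel K) x y :
  connect e x y -> x != y -> exists2 z, e x z & connect e z y.
Proof.
move=> /connectP[[|z s] /= + ->]; first by rewrite eqxx.
by move=> /andP[xz zs] _; exists z => //; apply/connectP; exists s.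
Qed.

Lemma uniq_size_card (K : finType) (s : seq K) : uniq s -> (size s <= #|K|)%N.
Proof. by move=> /card_uniqP <-; exact: max_card. Qed.

Section embeddings.
Variables (G1 : ograph) (a0 : arcs G1).
Hypothesis far : ~~ uadj G1 osrc osnk.
Local Notation A := (arcs G1).
Local Notation hier := (hierarchical G1).

Lemma crosses_inner (c : A -> bool) : crosses c ->
  exists w : inner G1, connect (open_rel c) osrc (val w).
Proof.
move=> /connect_step/(_ (osrc_neq_osnk _))[z sz _].
have zi : z \notin [:: osrc; osnk].
  have [e _ h] := open_relP _ _ _ sz.
  rewrite !inE negb_or; apply/andP; split; apply/eqP => zE; subst z.
    by have := arc_ends_neq e; case: h => -[-> ->]; rewrite eqxx.
  by case/negP: far; have := arcP e; case: h => -[-> ->] h;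
    rewrite /uadj/undirected/= h ?orbT.
by exists (exist (fun v : G1 => v \notin [:: osrc; osnk]) z zi); exact: connect1.
Qed.

(** Each replacement adds to the cluster an inner vertex of the copy of an open
  arc at the source, because the terminals of the seed are not adjacent. *)
Lemma crosses_card k (c : arcs (hier k) -> bool) : crosses c ->
  (k.+1 < #|connect (open_rel c) osrc|)%N.
Proof.
elim: k c => [|k IH] c cc.
  have -> : 1%N.+1 = #|[set false; true]%SET| by rewrite cards2.
  apply: subset_leq_card; apply/fintype.subsetP => x; rewrite !inE.
  move=> /pred2P[]->; first exact: connect0.
  exact: cc.
have cc' : crosses (coarse c).
  by move: cc; rewrite /crosses/= inl_connect_coarse.
have {}IH := IH _ cc'.
have [y /open_relP[e ce eP] _] := connect_step cc' (osrc_neq_osnk _).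
have [w srcw] := crosses_inner ce.
have wC : connect (open_rel c) osrc (inr (e, w) : hier k.+1).
  have := copy_connect srcw; rewrite copy_src copy_inner; apply: connect_trans.
  rewrite -[osrc]/(inl osrc : hier k.+1) inl_connect_coarse.
  case: eP => [[-> _]|[_ <-]]; first exact: connect0.
  by rewrite open_connect_sym; apply: connect1; exact: open_rel_arc.
apply: (@leq_ltn_trans #|[set (inl x : hier k.+1) |
    x in connect (open_rel (coarse c)) osrc]%SET|).
  by rewrite card_imset//; exact: inl_inj.
apply: proper_card; apply/properP; split.
  apply/fintype.subsetP => _ /imsetP[x xC ->].
  by rewrite -topredE/= inl_connect_coarse.
by exists (inr (e, w)) => //; apply/negP => /imsetP[].
Qed.

(** [f] embeds [K] so that only the images of its terminals meet arcs outside of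
  the image. *)
Definition graph_block (K G : ograph) (f : K -> G) := [/\ injective f,
  forall x y, oarc x y -> oarc (f x) (f y),
  forall x y, x \notin [:: osrc; osnk] -> oarc (f x) y ->
    exists2 z, y = f z & oarc x z &
  forall x y, x \notin [:: osrc; osnk] -> oarc y (f x) ->
    exists2 z, y = f z & oarc z x].

Lemma graph_block_replace (K G : ograph) (f : K -> G) : graph_block f ->
  exists2 F : replace_arcs G1 K -> replace_arcs G1 G, graph_block F &
    forall (e : arcs K) (E : arcs G), f (atail e) = atail E ->
      f (ahead e) = ahead E -> forall v, F (copy_vert e v) = copy_vert E v.
Proof.
move=> [fI fA fo fi].
pose fa (e : arcs K) : arcs G := exist (fun e => oarc e.1 e.2)
  (f (atail e), f (ahead e)) (fA _ _ (arcP e)).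
have faI : injective fa.
  by move=> e e' ee'; apply: arc_eq; apply: fI;
    [exact: (congr1 (@atail _) ee')|exact: (congr1 (@ahead _) ee')].
pose F (q : rvert G1 K) : rvert G1 G := match q with
  | inl x => inl (f x) | inr (e, w) => inr (fa e, w) end.
have Fcopy e v : F (copy_vert e v) = copy_vert (fa e) v.
  by case: (copyP e v) => [->|->|w ->]; rewrite ?copy_src ?copy_snk ?copy_inner.
have touch e (v : G1) x : x \notin [:: osrc; osnk : K] -> copy_vert e v = inl (f x) ->
    exists e', e = fa e'.
  move=> xi; case: copyP => // _ [ex].
    have [|z he xz] := fo _ (ahead e) xi; first by rewrite -ex arcP.
    by exists (exist (fun e => oarc e.1 e.2) (x, z) xz); exact: arc_eq.
  have [|z he xz] := fi _ (atail e) xi; first by rewrite -ex arcP.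
  by exists (exist (fun e => oarc e.1 e.2) (z, x) xz); exact: arc_eq.
have inner_copy (e : arcs G) (v : G1) (q : replace_arcs G1 K) :
    q \notin [:: osrc; osnk] -> copy_vert e v = F q ->
    exists2 e', e = fa e' & q = copy_vert e' v.
  case: q => [x xi|[e' w] _] /=.
    move=> evx; have xi' : x \notin [:: osrc; osnk : K].
      by apply: contra xi; rewrite !inE.
    have [e' ee'] := touch _ _ _ xi' evx; exists e' => //.
    move: evx; rewrite ee' -Fcopy.
    by case: copyP => // _ [] /fI->.
  by case: copyP => // w' -> [-> ->]; exists e'; rewrite ?copy_inner.
have repP (L : ograph) (p q : replace_arcs G1 L) : oarc p q ->
    exists e u v, [/\ oarc u v, p = copy_vert e u & q = copy_vert e v].
  move=> /existsP[e /existsP[u /existsP[v /and3P[uv /eqP<- /eqP<-]]]].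
  by exists e, u, v.
have repI (L : ograph) e u v : oarc u v ->
    @oarc (replace_arcs G1 L) (copy_vert e u) (copy_vert e v).
  move=> uv; apply/existsP; exists e; apply/existsP; exists u.
  by apply/existsP; exists v; rewrite uv !eqxx.
exists F; last first.
  move=> e E te he v; rewrite Fcopy; congr copy_vert; exact: arc_eq.
split.
- move=> [x|[e w]] [y|[e' w']] // Fxy.
    by congr inl; apply: fI; case: Fxy.
  have [ee' ->] : fa e = fa e' /\ w = w' by case: Fxy => h1 h2 ->; split; first exact: arc_eq.
  by rewrite (faI _ _ ee').
- move=> p q /repP[e [u [v [uv -> ->]]]]; rewrite !Fcopy; exact: repI.
- move=> p q pi /repP[e [u [v [uv /esym/(inner_copy _ _ _ pi)[e' -> ->] ->]]]].
  by exists (copy_vert e' v); rewrite ?Fcopy//; exact: repI.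
- move=> p q pi /repP[e [u [v [uv -> /esym/(inner_copy _ _ _ pi)[e' -> ->]]]]].
  by exists (copy_vert e' u); rewrite ?Fcopy//; exact: repI.
Qed.

(** Every arc of the [(k + m)]-th graph lies in a copy of the [k]-th one, grown from
  an arc of the [m]-th one; its position there is read off its [k] innermost
  digits. *)
Lemma graph_block_hier k m r : size r = (k + m)%N ->
  exists f : hier k -> hier (k + m), [/\ graph_block f,
    f (atail (arc_of a0 k (take k r))) = atail (arc_of a0 (k + m) r) &
    f (ahead (arc_of a0 k (take k r))) = ahead (arc_of a0 (k + m) r)].
Proof.
elim: k r => [|k IH] r rk.
  set E := arc_of a0 (0 + m) r.
  exists (fun b : bool => if b then ahead E else atail E); split => //.
  have /eqP n12 := arc_ends_neq E.
  split.
  - by move=> [] [] // h; case: n12; rewrite h.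
  - by move=> [] [] //= _; exact: arcP.
  - by case.
  - by case.
case: r rk => // a r [rk]; have [f [/graph_block_replace[F FB FC] ft fh]] := IH r rk.
exists F; split => //; exact: FC.
Qed.

(** The root of an edge-rooted graph is unordered. *)
Definition root_at k r (g : egraph) (f : hier k -> nat) :=
  (f (atail (arc_of a0 k r)) = (groot g).1 /\
   f (ahead (arc_of a0 k r)) = (groot g).2) \/
  (f (atail (arc_of a0 k r)) = (groot g).2 /\
   f (ahead (arc_of a0 k r)) = (groot g).1).

(** A copy of the [k]-th graph inside [g], with the root at position [r], attached to
  the rest of [g] by its terminals only. *)
Definition edge_block k r (g : egraph) (f : hier k -> nat) := [/\ injective f,
  forall x y, uadj _ x y -> gadj g (f x) (f y),
  forall x n, x \notin [:: osrc; osnk] -> gadj g (f x) n ->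
    exists2 y, n = f y & uadj _ x y &
  root_at r g f].

Lemma rooted_adjP (K : ograph) (E : arcs K) m n :
  reflect (exists x y : K, [/\ uadj _ x y, pickle x = m & pickle y = n])
    (gadj (rooted E) m n).
Proof.
rewrite /rooted /=; apply: (iffP existsP).
  by case=> x /existsP[y /and3P[? /eqP ? /eqP ?]]; exists x, y.
by case=> x [y [? <- <-]]; exists x; apply/existsP; exists y; apply/and3P.
Qed.

Lemma edge_block_hier k m r : size r = (k + m)%N ->
  exists f, @edge_block k (take k r) (rooted (arc_of a0 (k + m) r)) f.
Proof.
move=> /graph_block_hier[f [[fI fA fo fi] ft fh]].
have pI : injective (@pickle (hier (k + m))) := pcan_inj pickleK.
exists (pickle \o f); split.
- by apply: inj_comp.
- move=> x y xy; apply/rooted_adjP; exists (f x), (f y); split => //.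
  by apply/orP; case/orP: xy => /fA; [left|right].
- move=> x n xi /rooted_adjP[u [v [uv /pI ux <-]]]; subst u.
  case/orP: uv => [/(fo _ _ xi)|/(fi _ _ xi)] [z -> xz];
    by exists z => //; apply/orP; auto.
- by left; rewrite /= ft fh.
Qed.

Lemma root_ball_walk g n u v s : u = (groot g).1 \/ u = (groot g).2 ->
  is_walk (gadj g) u v s -> (size s <= n)%N -> root_ball g n v.
Proof.
move=> gu uv sn.
have vu : gvert g u.
  case: gu => ->; first exact: gadj_vert (groot_adj g).
  by have := groot_adj g; rewrite gadj_sym => /gadj_vert.
have vv : gvert g v.
  move/andP: uv => [+ /eqP <-]; elim: s u vu {gu sn} => //= z s IH u _.
  by move=> /andP[uz]; apply: IH; apply: (@gadj_vert _ _ u); rewrite gadj_sym.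
split => //; have uvs : exists2 s, is_walk (gadj g) u v s & (size s <= n)%N by exists s.
have uve : exists s, is_walk (gadj g) u v s by exists s.
by case: gu => uE; subst u; [left|right]; apply/graph_dist_le.
Qed.

Lemma hier_in_ball k r g (f : hier k -> nat) x :
  (forall x y, uadj _ x y -> gadj g (f x) (f y)) -> root_at r g f ->
  root_ball g #|hier k| (f x).
Proof.
move=> fA fr; set e := arc_of a0 k r in fr.
have /connectP[p0 p0P xE] := oconn (atail e) x.
case/shortenP: p0P xE => p pP pu _ xE.
apply: (@root_ball_walk _ _ (f (atail e)) _ (map f p)).
- by case: fr => -[-> _]; [left|right].
- apply/andP; split; last by rewrite last_map -xE.
  rewrite path_map; apply: sub_path pP => u v; exact: fA.
- rewrite size_map ltnW// -[(size p).+1]/(size (atail e :: p)).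
  exact: uniq_size_card.
Qed.

(** Blocks are seen in a ball that also contains the neighbours of the block. *)
Lemma edge_block_ball_iso k r g h (f : hier k -> nat) :
  edge_block r g f -> ball_iso #|hier k|.+1 g h ->
  exists f', @edge_block k r h f'.
Proof.
move=> fB [j [[jB jI jS] jA jr]].
have [fI fA fo fr] := fB.
have up (g' : egraph) n v : root_ball g' n v -> root_ball g' n.+1 v.
  by move=> [gv [|] vn]; split => //; [left|right]; exact: leqW.
have ext (g' : egraph) n v v' : root_ball g' n v -> gadj g' v v' ->
    root_ball g' n.+1 v'.
  have g1 : gvert g' (groot g').1 := gadj_vert (groot_adj g').
  have g2 : gvert g' (groot g').2.
    by have := groot_adj g'; rewrite gadj_sym => /gadj_vert.
  move=> [gv vn] vv'; case: vn => [/(graph_dist_le _ (gconn g1 gv))|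
    /(graph_dist_le _ (gconn g2 gv))] [s /andP[sP /eqP sv] sn].
    apply: (@root_ball_walk _ _ (groot g').1 _ (rcons s v')); first by left.
      by rewrite /is_walk rcons_path sP sv vv' last_rcons eqxx.
    by rewrite size_rcons.
  apply: (@root_ball_walk _ _ (groot g').2 _ (rcons s v')); first by right.
    by rewrite /is_walk rcons_path sP sv vv' last_rcons eqxx.
  by rewrite size_rcons.
have fb x : root_ball g #|hier k| (f x) by exact: (hier_in_ball _ fA fr).
have fb1 x : root_ball g #|hier k|.+1 (f x) by exact: up.
have jfI : injective (j \o f).
  by move=> x y /= jxy; apply: fI; apply: jI => //; rewrite inE.
have jfA x y : uadj _ x y -> gadj h (j (f x)) (j (f y)).
  by move=> xy; rewrite jA//; exact: fA.
have jfr : root_at r h (j \o f).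
  by case: fr jr => -[] /= + + [] [j1 j2] => f1 f2;
     rewrite /root_at/= f1 f2 j1 j2; auto.
have jfb x : root_ball h #|hier k| (j (f x)) by exact: (@hier_in_ball _ _ _ (j \o f) _ jfA jfr).
exists (j \o f); split => // x n xi /= jxn.
have [n' n'b n'E] := jS _ (ext _ _ _ _ (jfb x) jxn); subst n.
move: jxn; rewrite jA// => /(fo _ _ xi)[y -> xy].
by exists y.
Qed.

End embeddings.

(** * Percolation inside a block *)

Section block_percolation.
Variables (G1 : ograph) (a0 : arcs G1).
Hypothesis far : ~~ uadj G1 osrc osnk.
Local Notation A := (arcs G1).
Local Notation hier := (hierarchical G1).
Variables (g : egraph) (k : nat) (r : seq A) (f : hier k -> nat).
Hypothesis fB : edge_block a0 r g f.
Implicit Type w : config (edge g).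

Lemma open_adj_sym w : symmetric (open_adj w).
Proof. by move=> x y; rewrite /open_adj minnC maxnC. Qed.

Lemma open_adj_gadj w x y : open_adj w x y -> gadj g x y.
Proof.
rewrite /open_adj; case: insubP => // e /andP[_ /=]; rewrite /minn /maxn.
by case: ifP => // _ + _ _; rewrite gadj_sym.
Qed.

Definition block_cfg w : arcs (hier k) -> bool :=
  fun e => open_adj w (f (atail e)) (f (ahead e)).

Lemma block_rel w x y : uadj _ x y -> open_adj w (f x) (f y) ->
  open_rel (block_cfg w) x y.
Proof.
move=> /orP[] xy wxy; apply/open_relP.
  by exists (exist (fun e => oarc e.1 e.2) (x, y) xy) => //; left.
exists (exist (fun e => oarc e.1 e.2) (y, x) xy) => //; last by right.
by rewrite /block_cfg /atail/ahead/= open_adj_sym.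
Qed.

Lemma block_connect w x y : connect (open_rel (block_cfg w)) x y ->
  open_cluster w (f x) (f y).
Proof.
move=> /connectP[s sP ->]; exists (map f s).
rewrite /is_walk last_map eqxx andbT path_map; apply: sub_path sP => u v /=.
move=> /open_relP[e]; rewrite /block_cfg => + [[<- <-]//|[<- <-]].
by rewrite open_adj_sym.
Qed.

Lemma cluster_closed w (C : set nat) x :
  (forall u v, C u -> open_adj w u v -> C v) -> C x -> open_cluster w x `<=` C.
Proof.
move=> CC + y [s /andP[sP /eqP <-]]; elim: s x sP => //= z s IH x.
by move=> /andP[xz /IH h] /CC/(_ xz).
Qed.

(** If the root reaches no terminal, its cluster stays in the block. *)
Lemma block_no_percolation w :
  terminals (block_cfg w) (arc_of a0 k r) (true, true) = (false, false) ->
  ~ root_percolates g w.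
Proof.
move: fB => [fI fA fo fr]; set c := block_cfg w; set e := arc_of a0 k r.
pose C := reached c e (true, true); case=> srcN snkN.
have CC u v : (f @` [set x | C x]) u -> open_adj w u v -> (f @` [set x | C x]) v.
  move=> [x Cx <-] fxv; have xi : x \notin [:: osrc; osnk].
    by rewrite !inE; apply/negP => /pred2P[] xE; move: Cx;
      rewrite /C /= xE ?srcN ?snkN.
  have [y vE xy] := fo _ _ xi (open_adj_gadj fxv); exists y => //=.
  rewrite /C -(closed_under_connect (@reached_closed _ c e (true, true)) (x := x))//.
  by apply: connect1; apply: block_rel => //; rewrite -vE.
have fin : finite_set (f @` [set x | C x]).
  by apply: finite_image; exact: finite_finset.
have tC : (f @` [set x | C x]) (f (atail e)).
  by exists (atail e) => //=; rewrite /C /reached connect0.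
have hC : (f @` [set x | C x]) (f (ahead e)).
  by exists (ahead e) => //=; rewrite /C /reached connect0 orbT.
have no x : (f @` [set x | C x]) x -> ~ infinite_set (open_cluster w x).
  by move=> Cx; apply; apply: sub_finite_set fin; exact: cluster_closed.
by case: fr => -[t h]; rewrite /root_percolates/= -t -h => -[] /no; apply.
Qed.

(** Once the terminals are connected, reaching one of them adds to the cluster of
  the root the large cluster of [crosses_card]. *)
Lemma block_big_cluster w : crosses (block_cfg w) ->
  terminals (block_cfg w) (arc_of a0 k r) (true, true) <> (false, false) ->
  exists s : seq nat, [/\ uniq s, (k < size s)%N &
    [set` s] `<=` open_cluster w (groot g).1 \/
    [set` s] `<=` open_cluster w (groot g).2].
Proof.
move: fB => [fI fA fo fr]; set c := block_cfg w; set e := arc_of a0 k r.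
move=> cc ter.
have sat : (terminals c e (true, true)).1 = (terminals c e (true, true)).2.
  exact: terminals_saturated.
have src : reached c e (true, true) osrc.
  by move: ter sat; rewrite /terminals; do 2!case: reached.
exists (map f (enum (connect (open_rel c) osrc))); split.
- by rewrite map_inj_uniq// enum_uniq.
- by rewrite size_map -cardE; exact/ltnW/crosses_card.
have sub x : connect (open_rel c) x osrc ->
    [set` map f (enum (connect (open_rel c) osrc))] `<=` open_cluster w (f x).
  move=> xs n /= /mapP[y]; rewrite mem_enum => ys ->.
  by apply: block_connect; apply: connect_trans xs ys.
move: src => /orP[]/andP[_ /sub]; case: fr => -[<- <-]; tauto.
Qed.


Fixpoint words n : seq (seq A) :=
  if n is n'.+1 then [seq a :: s | a <- enum {: A}, s <- words n'] else [:: [::]].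

Lemma mem_words n s : (s \in words n) = (size s == n).
Proof.
elim: n s => [|n IH] s /=; first by rewrite inE; case: s.
apply/allpairsP/idP => [[[a t] /= [_ + ->]]|]; first by rewrite IH.
by case: s => // a s sn; exists (a, s); rewrite /= mem_enum IH.
Qed.

Lemma words_uniq n : uniq (words n).
Proof.
elim: n => //= n IH; apply: allpairs_uniq => //; first exact: enum_uniq.
by move=> [a s] [b t] _ _ [-> ->].
Qed.

(** The state in [t] of the arc at position [s], outermost digit first. *)
Fixpoint leaf n : cfg G1 n -> seq A -> bool :=
  match n return cfg G1 n -> seq A -> bool with
  | n'.+1 => fun (t : {ffun A -> cfg G1 n'}) s => leaf (t (head a0 s)) (behead s)
  | 0 => fun b _ => b
  end.

Lemma treeP n (v : seq A -> bool) (t : cfg G1 n) :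
  tree n v = t <-> {in words n, forall s, v (rev s) = leaf t s}.
Proof.
elim: n v t => [|n IH] v t /=.
  split=> [<- s|]; first by rewrite inE => /eqP->.
  by move=> /(_ [::] (mem_head _ _)).
split=> [<- s|vt].
  rewrite -/(words n.+1) mem_words; case: s => // a s /= [sn].
  rewrite ffunE rev_cons; apply: (IH (fun r => v (rcons r a)) _).1 => //.
  by rewrite mem_words.
apply/ffunP => a; rewrite ffunE; apply/IH => s sn.
rewrite -rev_cons vt//; apply/allpairsP; exists (a, s).
by rewrite mem_enum.
Qed.

Variable R : realType.
Implicit Type p : R.

Fixpoint cfg_weight p n : cfg G1 n -> R :=
  match n return cfg G1 n -> R with
  | n'.+1 => fun t : {ffun A -> cfg G1 n'} => \prod_a cfg_weight p (t a)
  | 0 => fun b : bool => if b then p else 1 - p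
  end.

Lemma cfg_weight_leaf p n (t : cfg G1 n) :
  cfg_weight p t = \prod_(s <- words n) (if leaf t s then p else 1 - p).
Proof.
elim: n t => [|n IH] t /=; first by rewrite big_seq1.
rewrite big_allpairs_dep big_enum/=; apply: eq_bigr => a _.
by rewrite IH.
Qed.

Definition prob p n (F : pred (cfg G1 n)) : R := \sum_(t | F t) cfg_weight p t.

Lemma block_edges : exists2 iota : arcs (hier k) -> edge g, injective iota &
  forall w e, block_cfg w e = w (iota e).
Proof.
have [fI fA _ _] := fB.
have /choice[iota iotaP] (e : arcs (hier k)) : exists E : edge g,
    val E = (minn (f (atail e)) (f (ahead e)), maxn (f (atail e)) (f (ahead e))).
  have fe : gadj g (f (atail e)) (f (ahead e)).
    by apply: fA; rewrite /uadj/undirected/= arcP.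
  have fne : f (atail e) != f (ahead e).
    by apply/eqP => h; rewrite h gadj_irr in fe.
  have fE : (minn (f (atail e)) (f (ahead e)) < maxn (f (atail e)) (f (ahead e)))%N &&
     gadj g (minn (f (atail e)) (f (ahead e))) (maxn (f (atail e)) (f (ahead e))).
    move: fne; rewrite neq_ltn => /orP[] uv.
      by rewrite (minn_idPl (ltnW uv)) (maxn_idPr (ltnW uv)) uv fe.
    by rewrite (minn_idPr (ltnW uv)) (maxn_idPl (ltnW uv)) uv gadj_sym fe.
  by exists (exist (fun e : nat * nat => (e.1 < e.2)%N && gadj g e.1 e.2)
    (minn (f (atail e)) (f (ahead e)), maxn (f (atail e)) (f (ahead e))) fE).
exists iota => [e e' ee'|w e]; last first.
  rewrite /block_cfg /open_adj; case: insubP => [E _ EE|/negP[]].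
    by congr (w _); exact: (val_inj (etrans EE (esym (iotaP e)))).
  by rewrite -iotaP; case: (iota e).
have := iotaP e; rewrite ee' iotaP => -[]; rewrite /minn/maxn.
have /negP anti := oarc_asym (arcP e).
have same : f (atail e') = f (atail e) -> f (ahead e') = f (ahead e) -> e = e'.
  by move=> /fI ? /fI ?; exact: arc_eq.
have swap : f (atail e') = f (ahead e) -> f (ahead e') = f (atail e) -> e = e'.
  by move=> /fI h1 /fI h2; case: anti; rewrite -h1 -h2; exact: arcP.
by case: ifP => _; case: ifP => _; auto.
Qed.

Lemma arc_of_inj n s s' : size s = n -> size s' = n ->
  arc_of a0 n s = arc_of a0 n s' -> s = s'.
Proof.
elim: n s s' => [[] [] //|n IH] [//|a s] [//|a' s'] [sn] [s'n] /=.
by move=> /(sub_arc_inj far)[/(IH _ _ sn s'n) -> ->].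
Qed.

Definition block_tree w : cfg G1 k := tree k (block_cfg w \o arc_of a0 k).

Lemma cylinder_measurable (I : countType) (s : seq I) (b : I -> bool) :
  measurable [set w : config I | {in s, forall i, w i = b i}].
Proof.
elim: s => [|i s IH].
  by rewrite (_ : [set _ | _] = setT)//; apply/seteqP; split.
have mi : measurable [set w : config I | w i].
  by apply: sub_sigma_algebra; exists i.
have mib : measurable [set w : config I | w i = b i].
  case: (b i) => //; rewrite (_ : [set _ | _] = ~` [set w : config I | w i]).
    exact: measurableC.
  by apply/seteqP; split=> w /= => [->//|/negP/negbTE].
rewrite (_ : [set _ | _] = [set w : config I | w i = b i] `&`
  [set w : config I | {in s, forall j, w j = b j}]); first exact: measurableI.
apply/seteqP; split=> [w ws|w [wi ws] j].
  by split=> [|j js]; apply: ws; rewrite inE ?eqxx// js orbT.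
by rewrite inE => /predU1P[->|/ws].
Qed.

Lemma block_tree_cylinder (t : cfg G1 k) : exists (s : seq (edge g)) b,
  [/\ uniq s, [set w | block_tree w = t] = [set w | {in s, forall i, w i = b i}] &
   forall p, \prod_(i <- s) (if b i then p else 1 - p) = cfg_weight p t].
Proof.
have [iota iotaI iotaP] := block_edges.
pose h u := iota (arc_of a0 k (rev u)).
have hI u v : u \in words k -> v \in words k -> h u = h v -> u = v.
  rewrite !mem_words => /eqP uk /eqP vk /iotaI/arc_of_inj; rewrite !size_rev.
  by move=> /(_ uk vk)/(can_inj revK).
pose b E := has (fun u => (h u == E) && leaf t u) (words k).
have bh u : u \in words k -> b (h u) = leaf t u.
  move=> uk; apply/hasP/idP => [[v vk /andP[/eqP/hI ->//]]|tu].
  by exists u => //; rewrite eqxx.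
exists (map h (words k)), b; split.
- by rewrite map_inj_in_uniq ?words_uniq// => u v; exact: hI.
- apply/seteqP; split=> w /=.
    move=> /treeP wt _ /mapP[u uk ->]; rewrite bh//.
    by rewrite -wt//= iotaP.
  by move=> wt; apply/treeP => u uk; rewrite /= iotaP -bh// wt// map_f.
- by move=> p; rewrite big_map cfg_weight_leaf; apply: eq_big_seq => u /bh ->.
Qed.

Lemma block_event_measurable (F : pred (cfg G1 k)) :
  measurable [set w | F (block_tree w)].
Proof.
rewrite (_ : [set _ | _] = \bigcup_(t in [set t | F t]) [set w | block_tree w = t]).
  apply: fin_bigcup_measurable; first exact: finite_finset.
  move=> t _; have [s [b [_ -> _]]] := block_tree_cylinder t.
  exact: cylinder_measurable.
by apply/seteqP; split=> [w Fw|w [t Ft /= ->//]]; exists (block_tree w).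
Qed.

Lemma block_event_prob p (mu : probability (config (edge g)) R)
  (F : pred (cfg G1 k)) : is_bernoulli_product p mu ->
  mu [set w | F (block_tree w)] = (prob p F)%:E.
Proof.
move=> muP; pose D t := [set w | block_tree w = t].
have DE t : mu (D t) = (cfg_weight p t)%:E.
  by rewrite /D; have [s [b [su -> <-]]] := block_tree_cylinder t; rewrite -muP.
have mD t : measurable (D t).
  rewrite (_ : D t = [set w | pred1 t (block_tree w)]).
    exact: block_event_measurable.
  by apply/seteqP; split=> w /= /eqP.
pose s := [seq t <- enum {: cfg G1 k} | F t].
have -> : prob p F = \sum_(t <- s) cfg_weight p t.
  by rewrite big_filter big_enum_cond.
rewrite (_ : [set _ | _] = [set w | block_tree w \in s]); last first.
  by apply/seteqP; split=> w /=; rewrite /s mem_filter mem_enum andbT.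
have : uniq s by rewrite filter_uniq// enum_uniq.
elim: s => [_|t s IH /andP[ts us]].
  by rewrite big_nil (_ : [set _ | _] = set0) ?measure0//; apply/seteqP; split.
rewrite big_cons EFinD -IH// -DE.
rewrite (_ : [set _ | _] = D t `|` [set w | block_tree w \in s]); last first.
  by apply/seteqP; split=> w /=; rewrite inE; [case/predU1P|case=> [->|->]];
    rewrite ?eqxx ?orbT //; [left|right].
apply: measureU => //; first exact: (block_event_measurable (mem s)).
by apply/seteqP; split=> // w [/= ->]; rewrite (negbTE ts).
Qed.

End block_percolation.

(** * Independence of sub-blocks *)

Section iid.
Variables (R : realType) (I : finType).

(** The image of an independent family under a map applied to each coordinate is
  an independent family. *)
Lemma iid_image (C B : finType) (nu : C -> R) (T : C -> B) (F : {ffun I -> B} -> R) :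
  \sum_(t : {ffun I -> C}) (\prod_i nu (t i)) * F [ffun i => T (t i)] =
  \sum_(u : {ffun I -> B}) (\prod_i \sum_(c | T c == u i) nu c) * F u.
Proof.
rewrite (partition_big (fun t : {ffun I -> C} => [ffun i => T (t i)]) xpredT)//=.
apply: eq_bigr => u _; rewrite bigA_distr_big_dep mulr_suml.
apply: eq_big => [t|t /eqP<-]; last by [].
apply/eqP/familyP => [<- i|tu]; first by rewrite unfold_in ffunE.
by apply/ffunP => i; rewrite ffunE; apply/eqP; exact: tu.
Qed.

End iid.

Section expectation.
Variables (G1 : ograph) (a0 : arcs G1) (R : realType).
Hypothesis far : ~~ uadj G1 osrc osnk.
Local Notation A := (arcs G1).
Implicit Types (p : R) (n : nat).

Definition expect p n (F : cfg G1 n -> R) : R := \sum_t cfg_weight p t * F t.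

Lemma prob_expect p n (F : pred (cfg G1 n)) :
  prob p F = expect p (fun t => (F t)%:R).
Proof.
rewrite /prob big_mkcond; apply: eq_bigr => t _.
by case: (F t); rewrite ?mulr1 ?mulr0.
Qed.

Lemma expect_prod p n (F : A -> cfg G1 n -> R) :
  expect p (fun t : cfg G1 n.+1 => \prod_a F a ((t : {ffun A -> cfg G1 n}) a)) =
  \prod_a expect p (F a).
Proof.
by rewrite bigA_distr_bigA; apply: eq_bigr => t _; rewrite -big_split.
Qed.

Lemma expect_cst1 p n : expect p (fun _ : cfg G1 n => 1) = 1.
Proof.
elim: n => [|n IH].
  by rewrite /expect big_bool/= !mulr1 addrC subrK.
have := expect_prod p (fun (_ : A) (_ : cfg G1 n) => 1).
rewrite [RHS]big1 => [|a _]; last exact: IH.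
by move=> E; rewrite -[RHS]E; apply: eq_bigr => t _; rewrite big1.
Qed.

Lemma expect_marginal p n (F : cfg G1 n -> R) a :
  expect p (fun t : cfg G1 n.+1 => F ((t : {ffun A -> cfg G1 n}) a)) = expect p F.
Proof.
have := expect_prod p (fun (b : A) t => if b == a then F t else 1).
rewrite [RHS](bigD1 a)//= eqxx big1 ?mulr1 => [<-|b /negbTE ->]; last first.
  exact: expect_cst1.
apply: eq_bigr => t _; congr (_ * _); rewrite (bigD1 a)//= eqxx big1 ?mulr1// => b /negbTE ->.
by [].
Qed.

Lemma expectB p n (F F' : cfg G1 n -> R) :
  expect p (fun t => F t - F' t) = expect p F - expect p F'.
Proof. by rewrite /expect -sumrB; apply: eq_bigr => t _; rewrite mulrBr. Qed.

Lemma expectD p n (F F' : cfg G1 n -> R) :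
  expect p (fun t => F t + F' t) = expect p F + expect p F'.
Proof. by rewrite /expect -big_split; apply: eq_bigr => t _; rewrite mulrDr. Qed.

Lemma expect_sum p n (I : finType) (F : I -> cfg G1 n -> R) :
  expect p (fun t => \sum_i F i t) = \sum_i expect p (F i).
Proof. by rewrite exchange_big; apply: eq_bigr => t _; rewrite mulr_sumr. Qed.

Lemma eq_expect p n (F F' : cfg G1 n -> R) : F =1 F' -> expect p F = expect p F'.
Proof. by move=> e; apply: eq_bigr => t _; rewrite e. Qed.

Section unit_interval.
Variable p : R.
Hypothesis p01 : 0 <= p <= 1.

Lemma cfg_weight_ge0 n (t : cfg G1 n) : 0 <= cfg_weight p t.
Proof.
elim: n t => [|n IH] t /=; last by apply: prodr_ge0.
by case: t; [|rewrite subr_ge0]; case/andP: p01.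
Qed.

Lemma le_expect n (F F' : cfg G1 n -> R) : (forall t, F t <= F' t) ->
  expect p F <= expect p F'.
Proof. by move=> FF'; apply: ler_sum => t _; rewrite ler_wpM2l ?cfg_weight_ge0. Qed.

Lemma prob_ge0 n (F : pred (cfg G1 n)) : 0 <= prob p F.
Proof. by apply: sumr_ge0 => t _; exact: cfg_weight_ge0. Qed.

Lemma prob_le1 n (F : pred (cfg G1 n)) : prob p F <= 1.
Proof.
rewrite prob_expect -[leRHS](expect_cst1 p n); apply: le_expect => t.
by rewrite lern1 leq_b1.
Qed.

End unit_interval.

Definition cross_prob n p := prob p (@cross G1 n).

(** The polynomial f of the seed. *)
Definition seed_cross (q : R) := \sum_(u : {ffun A -> bool})
  (\prod_a if u a then q else 1 - q) * (crosses u)%:R.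

Lemma probC p n (F : pred (cfg G1 n)) : prob p (predC F) = 1 - prob p F.
Proof.
rewrite !prob_expect -[X in X - _](expect_cst1 p n) -expectB; apply: eq_expect => t /=.
by case: (F t); rewrite ?subrr ?subr0.
Qed.

Lemma cross_prob0 p : cross_prob 0 p = p.
Proof. by rewrite /cross_prob /prob big_mkcond big_bool/= addr0. Qed.

Lemma cross_probS n p : cross_prob n.+1 p = seed_cross (cross_prob n p).
Proof.
rewrite /cross_prob prob_expect /seed_cross.
transitivity (\sum_(u : {ffun A -> bool})
    (\prod_a \sum_(c | @cross G1 n c == u a) cfg_weight p c) * (crosses u)%:R).
  rewrite -iid_image; apply: eq_bigr => t _ /=; congr (_ * (crosses _)%:R).
  by apply/funext => a; rewrite ffunE.
apply: eq_bigr => u _; congr (_ * _); apply: eq_bigr => a _.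
case: (u a); last rewrite -probC; apply: eq_bigl => t; first by case: cross.
by rewrite /=; case: cross.
Qed.

Definition reach n w : pred (cfg G1 n) := fun t => root_ends a0 w t != (false, false).

Definition reach_prob n w p := prob p (@reach n w).

Lemma reachS n w (t : cfg G1 n.+1) : reach w t ->
  reach (behead w) ((t : {ffun A -> cfg G1 n}) (head a0 w)).
Proof. by apply: contraNneq => /= ->. Qed.

Lemma reach_all_cross n w (t : cfg G1 n.+1) :
  reach (behead w) ((t : {ffun A -> cfg G1 n}) (head a0 w)) ->
  (forall a, cross ((t : {ffun A -> cfg G1 n}) a)) -> reach w t.
Proof.
rewrite /reach /=; set S := root_ends a0 (behead w) _ => S0 tc.
have conn x : connect (open_rel (fun a => cross ((t : {ffun A -> cfg G1 n}) a))) x osrc.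
  have /connectP[s + ->] := oconn osrc x; rewrite open_connect_sym => sP.
  apply/connectP; exists s => //; apply: sub_path sP => u v /orP[] uv.
    by apply/open_relP; exists (exist (fun e => oarc e.1 e.2) (u, v) uv) => //; left.
  by apply/open_relP; exists (exist (fun e => oarc e.1 e.2) (v, u) uv) => //; right.
apply/eqP => -[+ _]; rewrite /reached !conn !andbT.
by move: S0; case: (S) => -[] [].
Qed.

Lemma reach_probS_le p n w : 0 <= p <= 1 ->
  reach_prob n.+1 w p <= reach_prob n (behead w) p.
Proof.
move=> p01; rewrite /reach_prob !prob_expect -(@expect_marginal p n _ (head a0 w)).
apply: le_expect => // t; rewrite ler_nat; case rt : (reach w t) => //.
by rewrite (reachS rt).
Qed.

(** The root that reaches a terminal of its sub-block can miss those of the block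
  only if one of the sub-blocks fails to connect its terminals. *)
Lemma reach_probS_ge p n w : 0 <= p <= 1 ->
  reach_prob n (behead w) p - #|{: A}|%:R * (1 - cross_prob n p) <=
  reach_prob n.+1 w p.
Proof.
move=> p01; rewrite /reach_prob [leRHS]prob_expect [X in X - _]prob_expect.
rewrite -(@expect_marginal p n _ (head a0 w)).
have -> : #|{: A}|%:R * (1 - cross_prob n p) = expect p (fun t : cfg G1 n.+1 =>
    \sum_a (~~ cross ((t : {ffun A -> cfg G1 n}) a))%:R).
  rewrite expect_sum mulr_natl -sumr_const; apply: eq_bigr => a _.
  by rewrite (@expect_marginal p n (fun u => (~~ cross u)%:R)) -prob_expect -probC.
rewrite -expectB; apply: le_expect => // t.
have [tc|] := boolP [forall a, cross ((t : {ffun A -> cfg G1 n}) a)].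
  rewrite lerBlDr; apply: le_trans (_ : (reach w t)%:R <= _).
    rewrite ler_nat; case: (boolP (reach (behead w) _)) => // rt.
    by rewrite (reach_all_cross rt)//; exact/forallP.
  by rewrite lerDl sumr_ge0.
rewrite negb_forall => /existsP[a ta]; rewrite lerBlDr (bigD1 a)//= ta.
apply: le_trans (_ : 1 <= _); first by rewrite lern1 leq_b1.
by rewrite addrCA lerDl addr_ge0// sumr_ge0.
Qed.

Definition touches (b : A) (x : G1) := (atail b == x) || (ahead b == x).

(** [a] is the outer digit. When all other sub-blocks are closed at both levels,
  the root can leave the arc [b] only at the terminals that [b] touches, and
  then reaches the corresponding ends of [a]; those must be inner vertices. *)
Definition sheltered (a b : A) :=
  (touches b osrc ==> (atail a \notin [:: osrc; osnk])) &&
  (touches b osnk ==> (ahead a \notin [:: osrc; osnk])).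

Lemma only_open_connect (c : A -> bool) b x y :
  (forall a, a != b -> ~~ c a) -> connect (open_rel c) x y -> x != y -> touches b y.
Proof.
move=> cb; rewrite open_connect_sym => yx xy.
have yx' : y != x by rewrite eq_sym.
have [z /open_relP[e ce ey] _] := connect_step yx yx'.
have <- : e = b by apply/eqP; apply: contraTT ce => /cb.
by rewrite /touches; case: ey => -[h1 h2]; rewrite ?h1 ?h2 eqxx ?orbT.
Qed.

Lemma touches_both b : ~~ (touches b osrc && touches b osnk).
Proof.
apply: contra far => /andP[bs bt]; have := arcP b.
have := osrc_neq_osnk G1; rewrite /uadj/undirected/=.
case/orP: bs => /eqP <-; case/orP: bt => /eqP <-; rewrite ?eqxx//.
  by move=> _ ->.
by move=> _ ->; rewrite orbT.
Qed.

Lemma only_open_crosses (c : A -> bool) b :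
  (forall a, a != b -> ~~ c a) -> ~~ crosses c.
Proof.
move=> cb; apply/negP => cc; have st := osrc_neq_osnk G1.
have := touches_both b; rewrite (only_open_connect cb cc st).
rewrite /crosses open_connect_sym in cc.
by rewrite (only_open_connect cb cc)// eq_sym.
Qed.

(** The sub-block [a] itself is closed as well, because the single arc [b] cannot
  connect its two terminals. *)
Lemma sheltered_reach n a b w (t : cfg G1 n.+2) :
  sheltered a b ->
  (forall a', a' != a -> ~~ cross ((t : {ffun A -> cfg G1 n.+1}) a')) ->
  (forall b', b' != b -> ~~ cross (((t : {ffun A -> cfg G1 n.+1}) a : {ffun A -> cfg G1 n}) b')) ->
  ~~ reach [:: a, b & w] t.
Proof.
move=> sab ta tb; rewrite /reach /= negbK.
set S := root_ends _ _ _; set c := fun b' => cross _.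
have cE : (fun a' => cross ((t : {ffun A -> cfg G1 n.+1}) a')) = fun=> false.
  apply/funext => a'; apply/negbTE; have [->|/ta//] := eqVneq a' a.
  exact: (only_open_crosses tb).
rewrite -[X in terminals X a]/(fun a' => cross ((t : {ffun A -> cfg G1 n.+1}) a')).
have noc x y : connect (open_rel (fun _ : A => false)) x y -> x = y.
  by move=> /connect_step h; apply/eqP/negPn/negP => /h[z /open_relP[]].
rewrite [X in terminals X a _]cE.
have key x : reached c b S x -> touches b x.
  move=> /orP[]/andP[_ h].
    have [<-|] := eqVneq (atail b) x; first by rewrite /touches eqxx.
    exact: (only_open_connect tb h).
  have [<-|] := eqVneq (ahead b) x; first by rewrite /touches eqxx orbT.
  exact: (only_open_connect tb h).
have nr x : x \in [:: osrc; osnk] -> ~~ reached (fun=> false) a (terminals c b S) x.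
  move=> xt; case/andP: sab => /implyP h1 /implyP h2.
  apply/negP => /orP[]/andP[/key bt /noc ax].
    by have := h1 bt; rewrite ax xt.
  by have := h2 bt; rewrite ax xt.
by rewrite /terminals !(negbTE (nr _ _)) ?inE ?eqxx ?orbT.
Qed.

(** The root reaching a terminal of the sub-block [b], the other sub-blocks of the
  inner level being closed, and those of the outer level being closed, are
  independent events. *)
Lemma reach_prob_sheltered p n a b w : 0 <= p <= 1 -> sheltered a b ->
  reach_prob n.+2 [:: a, b & w] p <= reach_prob n w p *
    (1 - (1 - cross_prob n p) ^+ #|{: A}|.-1 * (1 - cross_prob n.+1 p) ^+ #|{: A}|.-1).
Proof.
move=> p01 sab; rewrite mulrBr mulr1.
pose F' b' (u : cfg G1 n) : R := if b' == b then (reach w u)%:R else (~~ cross u)%:R.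
pose F a' (u : cfg G1 n.+1) : R := if a' == a then \prod_b' F' b' ((u : {ffun A -> cfg G1 n}) b')
  else (~~ cross u)%:R.
have notE m : expect p (fun u : cfg G1 m => (~~ cross u)%:R) = 1 - cross_prob m p.
  by rewrite -probC prob_expect.
have E1 : expect p (F a) = reach_prob n w p * (1 - cross_prob n p) ^+ #|{: A}|.-1.
  rewrite (@eq_expect p n.+1 (F a) (fun u : cfg G1 n.+1 =>
     \prod_b' F' b' ((u : {ffun A -> cfg G1 n}) b'))).
    rewrite expect_prod (bigD1 b)//= {1}/F' eqxx -prob_expect; congr (_ * _).
    rewrite -(cardC1 b) -prodr_const; apply: eq_big => // b' bb'.
    by rewrite /F' (negbTE bb') notE.
  by move=> u; rewrite /F eqxx.
have E2 : expect p (fun t : cfg G1 n.+2 => \prod_a' F a' ((t : {ffun A -> cfg G1 n.+1}) a')) =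
   reach_prob n w p * ((1 - cross_prob n p) ^+ #|{: A}|.-1 *
     (1 - cross_prob n.+1 p) ^+ #|{: A}|.-1).
  rewrite expect_prod (bigD1 a)//= E1 mulrA; congr (_ * _).
  rewrite -(cardC1 a) -prodr_const; apply: eq_big => // a' aa'.
  by rewrite /F (negbTE aa') notE.
rewrite -E2 /reach_prob !prob_expect.
rewrite -(@expect_marginal p n _ b).
rewrite -(@expect_marginal p n.+1 _ a) -expectB; apply: le_expect => // t.
rewrite (bigD1 a)//= {1}/F eqxx (bigD1 b)//= {1}/F' eqxx.
set X := reach w _; set Y := \prod_(_ | _ != b) _; set Z := \prod_(_ | _ != a) _.
have bool_prod (P : pred A) (c : A -> bool) :
    \prod_(i | P i) (c i)%:R = [forall i, P i ==> c i]%:R :> R.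
  have [h|] := boolP [forall i, P i ==> c i].
    by rewrite big1// => i Pi; have /implyP/(_ Pi)-> := forallP h i.
  rewrite negb_forall => /existsP[i]; rewrite negb_imply => /andP[Pi /negbTE ci].
  by rewrite (bigD1 i)//= ci mul0r.
have -> : Y = [forall b', (b' != b) ==>
    ~~ cross (((t : {ffun A -> cfg G1 n.+1}) a : {ffun A -> cfg G1 n}) b')]%:R.
  by rewrite -bool_prod; apply: eq_bigr => b' /negbTE bb'; rewrite /F' bb'.
have -> : Z = [forall a', (a' != a) ==> ~~ cross ((t : {ffun A -> cfg G1 n.+1}) a')]%:R.
  by rewrite -bool_prod; apply: eq_bigr => a' /negbTE aa'; rewrite /F aa'.
have rX : reach [:: a, b & w] t -> X by move=> /reachS/reachS.
set By := [forall b', _]; set Bz := [forall a', _].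
have noreach : By -> Bz -> ~~ reach [:: a, b & w] t.
  move=> /forallP yb /forallP za; apply: sheltered_reach => // [a' a'a|b' b'b].
    by have /implyP := za a'; exact.
  by have /implyP := yb b'; exact.
move: rX noreach; case: reach; case: X; case: By; case: Bz => //= h1 h2;
  rewrite ?mulr0 ?mulr1 ?mul0r ?subr0 ?subrr ?ler01 //; last by have := h1 isT.
all: by first [have := h2 isT isT|have := h1 isT].
Qed.

Lemma arc_at (x y : G1) : x != y -> exists b, touches b x.
Proof.
move=> xy; have [z /orP[] xz _] := connect_step (oconn x y) xy.
  by exists (exist (fun e => oarc e.1 e.2) (x, z) xz); rewrite /touches eqxx.
by exists (exist (fun e => oarc e.1 e.2) (z, x) xz); rewrite /touches eqxx orbT.
Qed.

(** Take an arc [a] at the source. If it starts there, its head is an inner vertex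
  and any [b] at the sink will do; if it ends there, its tail is an inner vertex
  and [b = a] will do. *)
Lemma sheltered_exists : exists a b, sheltered a b.
Proof.
have st := osrc_neq_osnk G1; have [a as_] := arc_at st.
have at_ : ~~ touches a osnk by have := touches_both a; rewrite as_.
have aht := arc_ends_neq a.
move: (as_) (at_); rewrite {1 2}/touches negb_or => /orP[]/eqP ax /andP[t1 t2].
  have [b bt] : exists b, touches b osnk by apply: (@arc_at _ osrc); rewrite eq_sym.
  have /negbTE bs : ~~ touches b osrc by have := touches_both b; rewrite bt andbT.
  exists a, b; rewrite /sheltered bs bt !inE !negb_or t2 andbT /=.
  by rewrite -ax eq_sym.
exists a, a; rewrite /sheltered as_ (negbTE at_) !inE !negb_or t1 andbT /= -ax.
by rewrite aht.
Qed.

End expectation.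

(** * The threshold of the seed *)

Section threshold.
Variables (G1 : ograph) (a0 : arcs G1) (R : realType).
Hypothesis far : ~~ uadj G1 osrc osnk.
Local Notation A := (arcs G1).
Local Notation seed_cross := (@seed_cross G1 R).
Local Notation cross_prob n := (@cross_prob G1 R n).
Implicit Types (p q : R) (n : nat).

Lemma continuous_sum (T : topologicalType) (I : Type) (s : seq I) (P : pred I)
  (F : I -> T -> R) : (forall i, P i -> continuous (F i)) ->
  continuous (fun x => \sum_(i <- s | P i) F i x).
Proof. by apply: continuous_big; exact: add_continuous. Qed.

Lemma continuous_prod (T : topologicalType) (I : Type) (s : seq I) (P : pred I)
  (F : I -> T -> R) : (forall i, P i -> continuous (F i)) ->
  continuous (fun x => \prod_(i <- s | P i) F i x).
Proof. by apply: continuous_big; exact: mul_continuous. Qed.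

Lemma continuous_coin (b : bool) : continuous (fun p : R => if b then p else 1 - p).
Proof.
case: b => p; first exact: cvg_id.
by apply: cvgB; [exact: cvg_cst|exact: cvg_id].
Qed.

Lemma cfg_weight_continuous n (t : cfg G1 n) : continuous (fun p : R => cfg_weight p t).
Proof.
elim: n t => [|n IH] t; first exact: continuous_coin.
by apply: continuous_prod => a _; exact: IH.
Qed.

Lemma prob_continuous n (F : pred (cfg G1 n)) : continuous (fun p : R => prob p F).
Proof. by apply: continuous_sum => t _; exact: cfg_weight_continuous. Qed.

Lemma seed_cross_continuous : continuous seed_cross.
Proof.
apply: continuous_sum => u _ p; apply: cvgM; last exact: cvg_cst.
by apply: (@continuous_prod _ _ _ _ (fun a p => if u a then p else 1 - p)) => a _;
  exact: continuous_coin.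
Qed.

Lemma coin_ge0 q (b : bool) : 0 <= q <= 1 -> 0 <= (if b then q else 1 - q).
Proof. by case: b => /andP[//]; rewrite subr_ge0. Qed.

Lemma coins_sum q :
  \sum_(u : {ffun A -> bool}) \prod_a (if u a then q else 1 - q) = 1.
Proof.
rewrite -(bigA_distr_bigA (fun (_ : A) (b : bool) => if b then q else 1 - q)).
by rewrite big1// => a _; rewrite big_bool/= addrC subrK.
Qed.

Lemma crosses_mono (u v : A -> bool) : (forall a, u a -> v a) ->
  crosses u -> crosses v.
Proof.
move=> uv /connectP[s sP sE]; apply/connectP; exists s => //.
apply: sub_path sP => x y /open_relP[e ue exy]; apply/open_relP.
by exists e => //; exact: uv.
Qed.

(** The monotone coupling of two coins. *)
Let coupled q q' (c : bool * bool) : R :=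
  if c.1 then if c.2 then q else 0 else if c.2 then q' - q else 1 - q'.

Lemma seed_cross_mono q q' : 0 <= q -> q <= q' -> q' <= 1 ->
  seed_cross q <= seed_cross q'.
Proof.
move=> q0 qq' q'1.
have coinE (h : bool * bool -> bool) x :
    (forall b : bool, \sum_(c | h c == b) coupled q q' c = if b then x else 1 - x) ->
    seed_cross x = \sum_(t : {ffun A -> bool * bool})
      (\prod_a coupled q q' (t a)) * (crosses (fun a => h (t a)))%:R.
  move=> hx; transitivity (\sum_(u : {ffun A -> bool})
    (\prod_a \sum_(c | h c == u a) coupled q q' c) * (crosses u)%:R).
    by apply: eq_bigr => u _; congr (_ * _); apply: eq_bigr => a _.
  rewrite -iid_image; apply: eq_bigr => t _; congr (_ * (crosses _)%:R).
  by apply/funext => a; rewrite ffunE.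
have sum4 (F : bool * bool -> R) (P : pred (bool * bool)) : \sum_(c | P c) F c =
   (if P (true, true) then F (true, true) else 0) +
   (if P (true, false) then F (true, false) else 0) +
   ((if P (false, true) then F (false, true) else 0) +
   (if P (false, false) then F (false, false) else 0)).
  transitivity (\sum_b \sum_b' if P (b, b') then F (b, b') else 0).
    by rewrite big_mkcond pair_bigA; apply: eq_bigr => -[].
  by rewrite !big_bool.
rewrite (coinE fst) => [|[]]; last 2 first.
- by rewrite sum4 /coupled/=; lra.
- by rewrite sum4 /coupled/=; lra.
rewrite (coinE snd q') => [|[]]; last 2 first.
- by rewrite sum4 /coupled/=; lra.
- by rewrite sum4 /coupled/=; lra.
apply: ler_sum => t _; have [bad|/existsPn good] := boolP [exists a, t a == (true, false)].
  by case/existsP: bad => a /eqP ta; rewrite (bigD1 a)//= ta /coupled/= !mul0r.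
apply: ler_wpM2l.
  apply: prodr_ge0 => a _; rewrite /coupled; case: (t a) => [] [] []//=;
    by rewrite ?subr_ge0.
rewrite ler_nat; case: (boolP (crosses (fun a => (t a).1))) => // h.
rewrite (crosses_mono _ h)// => a; have := good a.
by case: (t a) => -[] [].
Qed.

Lemma seed_cross01 q : 0 <= q <= 1 -> 0 <= seed_cross q <= 1.
Proof.
move=> q01; apply/andP; split.
  by apply: sumr_ge0 => u _; rewrite mulr_ge0// prodr_ge0// => a _; exact: coin_ge0.
rewrite -[leRHS](coins_sum q); apply: ler_sum => u _.
rewrite ler_piMr ?lern1 ?leq_b1// prodr_ge0// => a _; exact: coin_ge0.
Qed.

Lemma seed_cross0 : seed_cross 0 = 0.
Proof.
rewrite /seed_cross big1// => u _; have [/forallP u0|] := boolP [forall a, ~~ u a].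
  rewrite (_ : crosses u = false) ?mulr0//; apply/negbTE.
  apply: (only_open_crosses far (b := a0)) => a _; exact: u0.
rewrite negb_forall => /existsP[a]; rewrite negbK => ua.
by rewrite (bigD1 a)//= ua !mul0r.
Qed.

Lemma walk_closed_arc (u : A -> bool) x y s :
  is_walk (uadj G1) x y s -> ~~ connect (open_rel u) x y ->
  exists2 e, ~~ u e & [set atail e; ahead e]%SET \in traversed x s.
Proof.
move=> /andP[sP /eqP <-] {y}; elim: s x sP => [|z s IH] x /=; first by rewrite connect0.
move=> /andP[xz zs] nc.
have [e exz] : exists e : A, (atail e = x /\ ahead e = z) \/ (atail e = z /\ ahead e = x).
  case/orP: xz => xz.
    by exists (exist (fun e => oarc e.1 e.2) (x, z) xz); left.
  by exists (exist (fun e => oarc e.1 e.2) (z, x) xz); right.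
have [ue|ue] := boolP (u e).
  have xzc : connect (open_rel u) x z by apply: connect1; apply/open_relP; exists e.
  have [|f uf fs] := IH _ zs; first by apply: contra nc; exact: connect_trans.
  by exists f => //; rewrite inE fs orbT.
exists e => //; rewrite inE; apply/orP; left; apply/eqP.
by case: exz => -[-> ->] //; rewrite finset.setUC.
Qed.

Hypothesis paths : two_edge_disjoint_paths (uadj G1) osrc osnk.

(** A configuration that does not connect the terminals closes an arc on each of
  two edge-disjoint paths, so its weight is at most (1 - q)^2. *)
Lemma seed_cross_near1 : exists2 C : R, 0 < C &
  forall q, 0 <= q <= 1 -> 1 - seed_cross q <= C * (1 - q) ^+ 2.
Proof.
exists #|{: {ffun A -> bool}}|%:R.
  by rewrite ltr0n; apply/card_gt0P; exists [ffun => true].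
move=> q q01; rewrite -[X in X - _](coins_sum q) -sumrB.
rewrite mulr_natl -sumr_const; apply: ler_sum => u _.
have [cu|ncu] := boolP (crosses u); first by rewrite mulr1 subrr sqr_ge0.
rewrite mulr0 subr0; have [s [t [/andP[sw _] /andP[tw _] /hasPn dis]]] := paths.
have [e ue es] := walk_closed_arc sw ncu; have [f uf ft] := walk_closed_arc tw ncu.
have ef : f != e by apply/eqP => fe; have := dis _ ft; rewrite fe /= es.
rewrite (bigD1 e)//= (negbTE ue) (bigD1 f)//= (negbTE uf) expr2 mulrA.
have [q0 q1] := andP q01.
rewrite ler_piMr//; first by rewrite mulr_ge0// subr_ge0.
apply: prodr_ile1 => a _; rewrite coin_ge0//=.
by case: (u a) => //; rewrite lerBlDr lerDl.
Qed.

(** The set of q < 1 with f(q) <= q contains 0, stays away from 1 by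
  [seed_cross_near1], and contains its supremum by continuity. *)
Lemma seed_cross_threshold : exists s : R, [/\ 0 <= s, s < 1, seed_cross s <= s &
  forall q, s < q -> q < 1 -> q < seed_cross q].
Proof.
have [C C0 CP] := seed_cross_near1.
pose S := [set q : R | 0 <= q < 1 /\ seed_cross q <= q].
have S0 : S 0 by split; rewrite ?lexx ?ltr01// seed_cross0.
have Sub : ubound S (1 - C^-1).
  move=> q [/andP[q0 q1] fq]; rewrite leNgt; apply/negP => qC.
  have := CP q; rewrite q0 (ltW q1) => /(_ isT) h.
  have : C * (1 - q) < 1 by rewrite mulrC -ltr_pdivlMr// mul1r ltrBlDr addrC -ltrBlDr.
  rewrite -(ltr_pM2r (_ : 0 < 1 - q)) ?subr_gt0// mul1r -mulrA -expr2.
  by move=> /(le_lt_trans h); rewrite ltrD2l ltrN2 ltNge fq.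
have hS : has_sup S by split; [exists 0|exists (1 - C^-1)].
exists (sup S); split.
- by apply: ub_le_sup S0; case: hS.
- by apply: (@le_lt_trans _ _ (1 - C^-1));
    [apply: ge_sup => //; exists 0|rewrite gtrBl invr_gt0].
- rewrite leNgt; apply/negP => fs.
  have : \forall q \near sup S, 0 < seed_cross q - q.
    have fc : (seed_cross q - q) @[q --> sup S] --> seed_cross (sup S) - sup S.
      by apply: cvgB; [exact: seed_cross_continuous|exact: cvg_id].
    by apply: (@cvgr_gt _ _ _ _ _ _ fc); rewrite subr_gt0.
  move=> /nbhs_ballP[e /= e0 be]; have [q [q01 fq] qs] := sup_adherent e0 hS.
  have : 0 < seed_cross q - q.
    apply: be; rewrite /ball/= ger0_norm ?subr_ge0; first by rewrite ltrBlDr addrC -ltrBlDr.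
    by apply: ub_le_sup; [case: hS|split].
  by rewrite subr_gt0 ltNge fq.
- move=> q sq q1; rewrite ltNge; apply/negP => fq.
  have : q <= sup S.
    apply: ub_le_sup; first by case: hS.
    split => //; rewrite q1 andbT (le_trans _ (ltW sq))//.
    by apply: ub_le_sup S0; case: hS.
  by rewrite leNgt sq.
Qed.

Variable s : R.
Hypotheses (s_ge0 : 0 <= s) (s_lt1 : s < 1) (s_fix : seed_cross s <= s)
  (s_max : forall q, s < q -> q < 1 -> q < seed_cross q).

Lemma cross_prob01 n p : 0 <= p <= 1 -> 0 <= cross_prob n p <= 1.
Proof. by move=> p01; apply/andP; split; [exact: prob_ge0|exact: prob_le1]. Qed.

Lemma cross_prob_mono n p q : 0 <= p -> p <= q -> q <= 1 ->
  cross_prob n p <= cross_prob n q.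
Proof.
move=> p0 pq q1; have p01 : 0 <= p <= 1 by rewrite p0 (le_trans pq).
have q01 : 0 <= q <= 1 by rewrite q1 (le_trans p0).
elim: n => [|n IH]; first by rewrite !cross_prob0.
have /andP[cp _] := cross_prob01 n p01; have /andP[_ cq] := cross_prob01 n q01.
by rewrite !cross_probS; exact: seed_cross_mono.
Qed.

Lemma cross_prob_sub n p : 0 <= p -> p <= s -> cross_prob n p <= s.
Proof.
move=> p0 ps; elim: n => [|n IH]; first by rewrite cross_prob0.
rewrite cross_probS; apply: le_trans s_fix; apply: seed_cross_mono (ltW s_lt1) => //.
have p01 : 0 <= p <= 1 by rewrite p0 (le_trans ps)// ltW.
by have /andP[] := cross_prob01 n p01.
Qed.

Lemma seed_cross1 : seed_cross 1 = 1.
Proof.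
have [C _ /(_ 1)] := seed_cross_near1; rewrite subrr expr0n/= mulr0 ler01 lexx.
move=> /(_ isT); rewrite subr_le0 => h; apply/eqP; rewrite eq_le h andbT.
by have := @seed_cross01 1; rewrite ler01 lexx => /(_ isT)/andP[].
Qed.

Lemma seed_cross_ge q : s < q -> q <= 1 -> q <= seed_cross q.
Proof.
move=> sq; rewrite le_eqVlt => /predU1P[->|]; first by rewrite seed_cross1.
by move=> q1; apply/ltW/s_max.
Qed.

Lemma cross_prob_super n p : s < p -> p <= 1 ->
  s < cross_prob n p /\ cross_prob n p <= cross_prob n.+1 p.
Proof.
move=> sp p1; have p01 : 0 <= p <= 1 by rewrite p1 (le_trans s_ge0)// ltW.
have step m : s < cross_prob m p -> cross_prob m p <= cross_prob m.+1 p.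
  move=> sm; rewrite cross_probS; apply: seed_cross_ge => //.
  by have /andP[] := cross_prob01 m p01.
have sm : s < cross_prob n p.
  elim: n => [|n IH]; first by rewrite cross_prob0.
  exact: lt_le_trans IH (step _ IH).
by split => //; exact: step.
Qed.

(** The iterates increase to a fixed point of f above [s], which can only be 1. *)
Lemma cross_prob_cvg1 p : s < p -> p <= 1 -> cross_prob n p @[n --> \oo] --> (1 : R).
Proof.
move=> sp p1; have p01 : 0 <= p <= 1 by rewrite p1 (le_trans s_ge0)// ltW.
have nd : nondecreasing_seq (fun n => cross_prob n p).
  by apply/nondecreasing_seqP => n; exact: (cross_prob_super n sp p1).2.
have ub : has_ubound (range (fun n => cross_prob n p)).
  by exists 1 => _ [n _ <-]; have /andP[] := cross_prob01 n p01.
have := nondecreasing_cvgn nd ub; set L := sup _ => cL.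
have fL : seed_cross L = L.
  apply: (@cvg_unique _ (@Rhausdorff R) ((fun n => cross_prob n.+1 p) @ \oo)).
    rewrite (_ : (fun n => cross_prob n.+1 p) = seed_cross \o (fun n => cross_prob n p)).
      by apply: cvg_comp cL _; exact: seed_cross_continuous.
    by apply/funext => n; rewrite /= cross_probS.
  by move: cL; rewrite -(@cvg_shiftS R (fun n => cross_prob n p) (nbhs L)).
have L1 : L <= 1 by apply: ge_sup; [exists (cross_prob 0 p); exists 0%N|
  move=> _ [n _ <-]; have /andP[] := cross_prob01 n p01].
have sL : s < L.
  apply: lt_le_trans sp _; rewrite -[leLHS](@cross_prob0 G1).
  by apply: ub_le_sup => //; exists 0%N.
suff -> : 1 = L by [].
apply/eqP; rewrite eq_le L1 andbT leNgt; apply/negP => /(s_max sL).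
by rewrite fL ltxx.
Qed.

Lemma cross_prob_halving p0 : s < p0 -> p0 <= 1 -> exists n0, forall n p,
  (n0 <= n)%N -> p0 <= p -> p <= 1 ->
  1 - cross_prob n.+1 p <= (1 - cross_prob n p) / 2.
Proof.
move=> sp p1; have [C C0 CP] := seed_cross_near1.
have e0 : 0 < (C * 2)^-1 by rewrite invr_gt0 mulr_gt0.
have [n0 _ n0P] : \forall n \near \oo, 1 - (C * 2)^-1 < cross_prob n p0.
  by apply: (@cvgr_gt _ _ _ _ _ _ (cross_prob_cvg1 sp p1)); rewrite ltrBlDl ltrDr.
exists n0 => n p n0n pp p1'.
have p00 : 0 <= p0 by rewrite (le_trans s_ge0)// ltW.
have p01 : 0 <= p <= 1 by rewrite p1' (le_trans p00).
have /andP[c0 c1] := cross_prob01 n p01.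
have h : 1 - (C * 2)^-1 < cross_prob n p.
  by apply: lt_le_trans (n0P n n0n) _; exact: cross_prob_mono.
rewrite cross_probS; apply: le_trans (CP _ (cross_prob01 n p01)) _.
have hC : C * (1 - cross_prob n p) <= 2^-1.
  rewrite -ler_pdivlMl// -invfM lerBlDr addrC -lerBlDr; exact: ltW.
by rewrite expr2 mulrA mulrC ler_wpM2l ?subr_ge0.
Qed.

(** The losses m (1 - f^i(p)) of [reach_probS_ge] for i >= j add up to at most twice the
  first one. *)
Lemma reach_stable p n j u w : size u = n -> 0 <= p <= 1 ->
  (forall i, (j <= i)%N -> 1 - cross_prob i.+1 p <= (1 - cross_prob i p) / 2) ->
  `|reach_prob a0 (n + j) (u ++ w) p - reach_prob a0 j w p| <=
  2 * #|{: A}|%:R * (1 - cross_prob j p).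
Proof.
move=> <- p01 half {n}.
have up : reach_prob a0 (size u + j) (u ++ w) p <= reach_prob a0 j w p.
  elim: u => //= a u; apply: le_trans; exact: (@reach_probS_le _ a0 _ p _ (a :: u ++ w)).
(* with x' <= x / 2, a loss of m x is at most 2 m (x - x'), which telescopes *)
have low : reach_prob a0 j w p - 2 * #|{: A}|%:R *
    ((1 - cross_prob j p) - (1 - cross_prob (size u + j) p)) <=
    reach_prob a0 (size u + j) (u ++ w) p.
  elim: u {up} => [|a u IH] /=; first by rewrite subrr mulr0 subr0.
  have := @reach_probS_ge _ a0 _ p (size u + j) (a :: u ++ w) p01 => /= h.
  apply: le_trans h; have := half (size u + j)%N (leq_addl _ _).
  set x := cross_prob (size u + j) p in IH *; rewrite addSn.
  set y := cross_prob (size u + j).+1 p => hy.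
  have m0 : 0 <= #|{: A}|%:R :> R by [].
  set m := #|{: A}|%:R in IH m0 *.
  have : m * (1 - x) <= 2 * m * (y - x).
    by rewrite -mulrA mulrCA ler_wpM2l//; lra.
  by move: IH; rewrite !mulrBr !mulr1; lra.
have /andP[_ c1] := cross_prob01 (size u + j) p01.
rewrite ler0_norm ?subr_le0// opprB lerBlDr -lerBlDl; apply: le_trans low.
rewrite lerB// ler_wpM2l ?mulr_ge0//.
by rewrite gerBl subr_ge0.
Qed.

(** Disjoint pairs are counted, so that the factors of [reach_prob_sheltered] can be
  multiplied. *)
Fixpoint shelters (w : seq A) : nat :=
  if w is a :: w1 then if w1 is b :: w2 then (sheltered a b + shelters w2)%N else 0%N
  else 0%N.

Lemma seq2_ind (P : seq A -> Prop) : P [::] -> (forall a, P [:: a]) ->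
  (forall a b w, P w -> P [:: a, b & w]) -> forall w, P w.
Proof.
move=> P0 P1 P2 w; suff [] : P w /\ forall a, P (a :: w) by [].
by elim: w => [|a w [IH1 IH2]]; split => // b; exact: P2.
Qed.

Lemma reach_prob_critical p w : 0 <= p -> p <= s ->
  reach_prob a0 (size w) w p <=
  (1 - (1 - s) ^+ #|{: A}|.-1 * (1 - s) ^+ #|{: A}|.-1) ^+ shelters w.
Proof.
move=> p0 ps; have p01 : 0 <= p <= 1 by rewrite p0 (le_trans ps)// ltW.
set d := (1 - s) ^+ _.
have d0 : 0 <= d by rewrite exprn_ge0// subr_ge0 ltW.
have d1 : d <= 1 by apply: exprn_ile1; [rewrite subr_ge0 ltW|rewrite gerBl].
have dc n : d <= (1 - cross_prob n p) ^+ #|{: A}|.-1.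
  have cs := cross_prob_sub n p0 ps; have /andP[c0 c1] := cross_prob01 n p01.
  by rewrite lerXn2r ?nnegrE ?subr_ge0 ?lerB// ltW.
have c1 n : (1 - cross_prob n p) ^+ #|{: A}|.-1 <= 1.
  have /andP[c0 c1] := cross_prob01 n p01.
  by apply: exprn_ile1; [rewrite subr_ge0|rewrite gerBl].
elim/seq2_ind: w => [|a|a b w IH] /=; rewrite ?expr0; [exact: prob_le1..|].
rewrite exprD; have [sab|] := boolP (sheltered a b); last first.
  move=> _; rewrite expr0 mul1r; apply: le_trans IH.
  apply: le_trans (@reach_probS_le _ a0 _ p _ [:: a, b & w] p01) _.
  exact: (@reach_probS_le _ a0 _ p _ (b :: w) p01).
apply: le_trans (reach_prob_sheltered a0 far _ _ p01 sab) _.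
rewrite expr1 mulrC; apply: ler_pM => //; last 1 first.
- by rewrite lerB// ler_pM.
- by rewrite subr_ge0 mulr_ile1// (le_trans d0).
- exact: prob_ge0.
Qed.

(** Markov's inequality for 2 ^- shelters, whose sum over all words factors into
  sums over pairs of digits; one pair at least is sheltered. *)
Lemma shelters_count L N :
  wsum L.*2 (fun r : seq A => (shelters (rev r) < N)%:R) <=
  2 ^+ N * (#|{: A}|%:R ^+ 2 - 2^-1) ^+ L :> R.
Proof.
set W := fun n => wsum n (fun r : seq A => 2^-1 ^+ shelters (rev r) : R).
apply: (@le_trans _ _ (2 ^+ N * W L.*2)).
  rewrite -wsumZ; apply: ler_wsum => r _; case: ltnP => /= rN; last first.
    by rewrite mulr_ge0// exprn_ge0// invr_ge0.
  by rewrite exprVn ler_pdivlMr ?exprn_gt0// mul1r ler_eXn2l ?ltr1n// ltnW.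
rewrite ler_wpM2l ?exprn_ge0//.
have W0 n : 0 <= W n.
  rewrite -[leLHS](mul0rn _ (#|{: A}| ^ n)%N) -wsum_cst; apply: ler_wsum => r _.
  by rewrite exprn_ge0// invr_ge0.
elim: L => [|L IH]; first by rewrite /W/= expr0.
have [a1 [b1 s11]] := sheltered_exists far.
have -> : W L.+1.*2 = (\sum_(a : A) \sum_(b : A) 2^-1 ^+ sheltered a b) * W L.*2.
  rewrite doubleS {1}/W wsum_top mulr_suml; apply: eq_bigr => a _.
  rewrite wsum_top mulr_suml; apply: eq_bigr => b _.
  rewrite -wsumZ; apply: eq_wsum => r _.
  by rewrite !rev_rcons /= exprD.
rewrite exprS ler_pM//.
  by apply: sumr_ge0 => a _; apply: sumr_ge0 => b _; rewrite exprn_ge0// invr_ge0.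
have half1 (a b : A) : 2^-1 ^+ sheltered a b <= 1 :> R.
  by rewrite exprn_ile1// ?invr_ge0// invf_le1// ler1n.
rewrite pair_bigA/= (bigD1 (a1, b1))//= s11 expr1.
rewrite expr2 -natrM -card_prod.
rewrite (eq_bigl (predC1 (a1, b1)))//.
apply: (@le_trans _ _ (2^-1 + #|predC1 (a1, b1)|%:R)).
  by rewrite lerD2l -[leRHS]mulr_natl mulr1 -sumr_const; apply: ler_sum => p _; exact: half1.
rewrite cardC1; have : (0 < #|{: A * A}|)%N by apply/card_gt0P; exists (a1, b1).
case: #|_| => // M _ /=; rewrite -[M.+1%:R]natr1; lra.
Qed.

End threshold.

(** * Continuity for a graph with deeply sheltered blocks *)

Section deterministic.
Variables (G1 : ograph) (a0 : arcs G1) (R : realType).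
Hypothesis far : ~~ uadj G1 osrc osnk.
Hypothesis paths : two_edge_disjoint_paths (uadj G1) osrc osnk.
Local Notation A := (arcs G1).
Local Notation hier := (hierarchical G1).
Implicit Types (p e : R).

(** Even levels split words into pairs of digits exactly, from either end. *)
Definition sheltered_block L N (g : egraph) := exists r (f : hier L.*2 -> nat),
  [/\ size r = L.*2, (N <= shelters (rev r))%N & edge_block a0 r g f].

Lemma shelters_size (w : seq A) : (shelters w <= size w)%N.
Proof.
elim/seq2_ind: w => //= a b w IH; rewrite -add2n leq_add//.
by case: sheltered.
Qed.

Variable g : egraph.

Lemma block_terminals k r (f : hier k -> nat) (w : config (edge g)) : size r = k ->
  terminals (block_cfg f w) (arc_of a0 k r) (true, true) =
  root_ends a0 (rev r) (block_tree a0 f w).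
Proof. by move=> rk; rewrite root_hier// /block_tree root_tree. Qed.

Lemma block_crosses k (f : hier k -> nat) (w : config (edge g)) :
  crosses (block_cfg f w) = cross (block_tree a0 f w).
Proof. by rewrite /block_tree cross_tree -crosses_hier. Qed.

Definition edge_theta (p : R) : R := fine (bernoulli_product (edge g) p (root_percolates g)).

Lemma edge_thetaE p : (edge_theta p)%:E = bernoulli_product (edge g) p (root_percolates g).
Proof. by rewrite /edge_theta fineK// fin_num_measure//; exact: root_percolates_measurable. Qed.

Lemma edge_theta_ge0 p : 0 <= edge_theta p.
Proof. by rewrite -lee_fin edge_thetaE. Qed.

Lemma edge_theta_le k r (f : hier k -> nat) p : size r = k -> edge_block a0 r g f ->
  0 <= p <= 1 -> edge_theta p <= reach_prob a0 k (rev r) p.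
Proof.
move=> rk fB p01; rewrite -lee_fin edge_thetaE.
rewrite -(block_event_prob far fB (reach a0 (rev r)) (@bernoulli_productP R (edge g) p p01)).
apply: le_measure; rewrite ?inE; first exact: root_percolates_measurable.
  exact: (block_event_measurable far fB).
move=> w; apply: contraPP => /negP; rewrite /reach negbK => /eqP ter.
by apply: (block_no_percolation fB); rewrite block_terminals.
Qed.

Hypothesis gB : forall N, exists L, sheltered_block L N g.

Lemma block_sequence : exists (k : nat -> nat) (r : nat -> seq A)
    (f : forall N, hier (k N) -> nat), forall N,
  [/\ size (r N) = k N, (N <= k N)%N, (N <= shelters (rev (r N)))%N &
      edge_block a0 (r N) g (f N)].
Proof.
have /choice[L LP] := gB; exists (fun N => (L N).*2).
have /choice[r rP] := LP; exists r.
pose f N := sval (cid (rP N)); exists f => N; rewrite /f.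
case: cid => h /= [rk Nr hB]; split => //.
by rewrite -rk -size_rev; apply: leq_trans Nr (shelters_size _).
Qed.

Section sequence.
Variables (k : nat -> nat) (r : nat -> seq A) (f : forall N, hier (k N) -> nat).
Hypothesis kP : forall N,
  [/\ size (r N) = k N, (N <= k N)%N, (N <= shelters (rev (r N)))%N &
      edge_block a0 (r N) g (@f N)].

Let q N p := reach_prob a0 (k N) (rev (r N)) p : R.

Let both N : pred (cfg G1 (k N)) :=
  fun t => reach a0 (rev (r N)) t && cross t.

Let B N : set (config (edge g)) := [set w | both (block_tree a0 (@f N) w)].

Let mB N : measurable (B N).
Proof. by have [_ _ _ fB] := kP N; exact: (block_event_measurable far fB). Qed.

Let tail n := \bigcup_(N in [set N | (n <= N)%N]) B N.

Let mtail n : measurable (tail n).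
Proof. exact: bigcup_measurable. Qed.

(** Clusters of more than k N vertices for infinitely many N are infinite. *)
Lemma tail_percolates : \bigcap_n tail n `<=` root_percolates g.
Proof.
move=> w wt; apply: contrapT => /not_orP[/contrapT/finite_seqP[s1 s1P]].
move=> /contrapT/finite_seqP[s2 s2P].
have [N /= sN] := wt (maxn (size s1) (size s2)) I.
have [rk Nk _ fB] := kP N; rewrite /B /= /both => /andP[rw cw].
have [||s [us ss]] := block_big_cluster far fB (w := w).
- by rewrite block_crosses.
- by rewrite block_terminals//; exact/eqP.
have {}ss : (maxn (size s1) (size s2) < size s)%N.
  by apply: leq_trans ss; rewrite ltnS (leq_trans sN).
rewrite s1P s2P => -[] /(uniq_leq_size us); rewrite leqNgt (leq_ltn_trans _ ss)//.
  exact: leq_maxl.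
exact: leq_maxr.
Qed.

(** The reverse Fatou lemma for the events of [tail_percolates]. *)
Lemma both_le p e : 0 <= p <= 1 -> 0 < e ->
  \forall N \near \oo, prob p (@both N) <= edge_theta p + e.
Proof.
move=> p01 e0; pose mu := bernoulli_product (edge g) p.
have muP := @bernoulli_productP R (edge g) p p01.
suff [n nP] : exists n, (mu (tail n) <= (edge_theta p + e)%:E)%E.
  exists n => // N /= nN; have [_ _ _ fB] := kP N.
  rewrite -lee_fin -(block_event_prob far fB _ muP); apply: le_trans nP.
  by apply: le_measure; rewrite ?inE//; [exact: mB|move=> w wB; exists N].
apply: contrapT => /forallNP h.
have cm : mu \o tail @ \oo --> mu (\bigcap_n tail n).
  apply: nonincreasing_cvg_mu => //.
  - by rewrite (le_lt_trans (probability_le1 _ _)) ?ltry.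
  - exact: bigcapT_measurable.
  - move=> m n mn; apply/subsetPset => w [N /= nN wN]; exists N => //=.
    exact: leq_trans nN.
have : ((edge_theta p + e)%:E <= lim (mu \o tail @ \oo))%E.
  apply: lime_ge; first by apply/cvg_ex; eexists; exact: cm.
  by near=> n; rewrite ltW// ltNge; apply/negP/h.
rewrite (cvg_lim _ cm)// => h1.
have h2 : (mu (\bigcap_n tail n) <= mu (root_percolates g))%E.
  apply: le_measure; rewrite ?inE; [exact: bigcapT_measurable| |exact: tail_percolates].
  exact: root_percolates_measurable.
have := le_trans h1 h2; rewrite -edge_thetaE lee_fin.
by rewrite gerDl leNgt e0.
Unshelve. all: by end_near. Qed.

Variable s : R.
Hypotheses (s_ge0 : 0 <= s) (s_lt1 : s < 1) (s_fix : seed_cross G1 s <= s)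
  (s_max : forall q, s < q -> q < 1 -> q < seed_cross G1 q).

Let q01 p : s < p -> p <= 1 -> 0 <= p <= 1.
Proof. by move=> sp ->; rewrite (le_trans s_ge0)// ltW. Qed.

(** Above the threshold the events that the block connects its terminals have
  probability tending to 1, so [edge_theta_le] and [both_le] squeeze theta. *)
Lemma edge_theta_lim p e : s < p -> p <= 1 -> 0 < e ->
  \forall N \near \oo, `|edge_theta p - q N p| <= e.
Proof.
move=> sp p1 e0; have p01 := q01 sp p1; have e20 : 0 < e / 2 by rewrite divr_gt0.
have [n1 _ n1P] := both_le p01 e20.
have [n2 _ n2P] : \forall n \near \oo, 1 - e / 2 < cross_prob G1 n p.
  apply: (@cvgr_gt _ _ _ _ _ _ (cross_prob_cvg1 paths s_ge0 s_max sp p1)).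
  by rewrite ltrBlDl ltrDr.
exists (maxn n1 n2) => // N /=; rewrite geq_max => /andP[n1N n2N].
have [rk Nk _ fB] := kP N.
have h1 := edge_theta_le rk fB p01.
rewrite ler0_norm ?subr_le0// opprB lerBlDl.
have h2 := n1P _ n1N; have h3 := n2P _ (leq_trans n2N Nk).
have : q N p <= prob p (@both N) + (1 - cross_prob G1 (k N) p).
  rewrite -probC /q /reach_prob !prob_expect.
  rewrite -expectD.
  apply: le_expect => // t; rewrite -natrD ler_nat /both /=.
  by case: (reach _ _ t); case: (cross t).
move: h2 h3; rewrite /q; lra.
Qed.

Lemma edge_theta_continuous_sub p : 0 <= p -> p <= s ->
  edge_theta x @[x --> within `[0, 1]%classic (nbhs p)] --> edge_theta p.
Proof.
move=> p0 ps; apply/cvgrPdist_le => e e0.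
set d := (1 - s) ^+ #|{: A}|.-1 * (1 - s) ^+ #|{: A}|.-1.
have d0 : 0 < d by rewrite mulr_gt0 ?exprn_gt0 ?subr_gt0.
have d1 : d <= 1.
  by rewrite mulr_ile1// ?exprn_ge0 ?exprn_ile1 ?subr_ge0 ?(ltW s_lt1)// gerBl.
have : `|1 - d| < 1 by rewrite ger0_norm ?subr_ge0// gtrBl.
move=> /cvg_expr dn; have [N _ NP] := @cvgr_lt _ _ _ _ _ _ dn e e0.
have [rk Nk Ns fB] := kP N.
have p1 := le_trans ps (ltW s_lt1); have p01 : 0 <= p <= 1 by rewrite p0.
have qp : q N p < e.
  apply: le_lt_trans (NP N (leqnn _)); rewrite /q.
  have := reach_prob_critical a0 far s_ge0 s_lt1 s_fix (rev (r N)) p0 ps.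
  rewrite size_rev rk => /le_trans; apply.
  by rewrite ler_wiXn2l ?subr_ge0 ?gerBl// ltW.
have qc : \forall t \near p, q N t < e.
  have qcp : q N t @[t --> p] --> q N p by exact: prob_continuous.
  by apply: (@cvgr_lt _ _ _ _ _ _ qcp).
near=> t; have t01 : 0 <= t <= 1.
  suff : t \in `[0, 1] by rewrite in_itv.
  by near: t; exact: withinT.
have tq : q N t < e by near: t; exact: cvg_within qc.
have hp := le_lt_trans (edge_theta_le rk fB p01) qp.
have ht := le_lt_trans (edge_theta_le rk fB t01) tq.
have := edge_theta_ge0 p; have := edge_theta_ge0 t; rewrite ler_norml; lra.
Unshelve. all: by end_near. Qed.

Lemma edge_theta_continuous_super p : s < p -> p <= 1 ->
  edge_theta x @[x --> within `[0, 1]%classic (nbhs p)] --> edge_theta p.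
Proof.
move=> sp p1; apply/cvgrPdist_le => e e0.
pose p0 := (s + p) / 2; have sp0 : s < p0 by rewrite /p0; lra.
have p0p : p0 < p by rewrite /p0; lra.
have p01 : p0 <= 1 by lra.
have [n0 n0P] := cross_prob_halving paths s_ge0 s_max sp0 p01.
set m := #|{: A}|%:R : R; have m0 : 0 <= m by [].
(* two limits, two changes of level, and one continuous polynomial *)
pose eta := e / 5; have eta0 : 0 < eta by rewrite /eta; lra.
have dm0 : 0 < eta / (2 * m + 1) by rewrite divr_gt0//; lra.
have [n1 _ n1P] : \forall n \near \oo, 1 - eta / (2 * m + 1) < cross_prob G1 n p0.
  apply: (@cvgr_gt _ _ _ _ _ _ (cross_prob_cvg1 paths s_ge0 s_max sp0 p01)).
  by rewrite ltrBlDl ltrDr.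
pose j := maxn n0 n1.
have p00 : 0 <= p0 by rewrite (le_trans s_ge0)// ltW.
have close N t : (j <= N)%N -> p0 <= t -> t <= 1 ->
    `|q N t - reach_prob a0 j (drop (k N - j) (rev (r N))) t| <= eta.
  move=> jN pt t1; have [rk Nk _ _] := kP N.
  have t01 : 0 <= t <= 1 by rewrite t1 (le_trans p00).
  have jk : (j <= k N)%N by exact: leq_trans Nk.
  have sz : size (take (k N - j) (rev (r N))) = (k N - j)%N.
    by rewrite size_take size_rev rk; case: ltngtP (leq_subr j (k N)).
  rewrite /q -{1}(cat_take_drop (k N - j) (rev (r N))) -{1}(subnK jk).
  apply: le_trans (reach_stable a0 _ sz t01 _) _.
    by move=> i ji; apply: n0P => //; apply: leq_trans ji; exact: leq_maxl.
  rewrite -/m; have cj : 1 - eta / (2 * m + 1) < cross_prob G1 j t.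
    apply: lt_le_trans (n1P j _) _; first exact: leq_maxr.
    by apply: cross_prob_mono.
  have : 2 * m * (eta / (2 * m + 1)) <= eta.
    by rewrite mulrCA ler_piMr ?(ltW eta0)// ler_pdivrMr ?mul1r; lra.
  apply: le_trans; rewrite ler_wpM2l//; [lra|].
  by rewrite lerBlDr addrC -lerBlDr ltW.
have near_words (ws : seq (seq A)) : \forall t \near p, forall w, w \in ws ->
    `|reach_prob a0 j w p - reach_prob a0 j w t| <= eta.
  elim: ws => [|w ws IH]; first by near=> t => w.
  have cw : \forall t \near p, `|reach_prob a0 j w p - reach_prob a0 j w t| <= eta.
    have wcp : reach_prob a0 j w t @[t --> p] --> reach_prob a0 j w p.
      by exact: prob_continuous.
    by move/cvgrPdist_le : wcp; exact.
  by near=> t => v; rewrite inE => /predU1P[->|]; [near: t|move: v; near: t].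
near=> t; have t01 : 0 <= t <= 1.
  suff : t \in `[0, 1] by rewrite in_itv.
  by near: t; exact: withinT.
have [t0 t1] := andP t01.
have p0t : p0 < t.
  by near: t; apply: cvg_within; exact: lt_nbhsr.
have tw : forall w, w \in words G1 j -> `|reach_prob a0 j w p - reach_prob a0 j w t| <= eta.
  by near: t; apply: cvg_within; exact: near_words.
have [n2 _ n2P] := edge_theta_lim sp p1 eta0.
have [n3 _ n3P] := edge_theta_lim (lt_trans sp0 p0t) t1 eta0.
pose N := maxn j (maxn n2 n3).
have jN : (j <= N)%N by exact: leq_maxl.
have h1 := n2P N (leq_trans (leq_maxl _ _) (leq_maxr _ _)).
have h2 := n3P N (leq_trans (leq_maxr _ _) (leq_maxr _ _)).
have h3 := close N p jN (ltW p0p) p1; have h4 := close N t jN (ltW p0t) t1.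
have [rk Nk _ _] := kP N.
have h5 : `|reach_prob a0 j (drop (k N - j) (rev (r N))) p -
    reach_prob a0 j (drop (k N - j) (rev (r N))) t| <= eta.
  by apply: tw; rewrite mem_words size_drop size_rev rk subKn// (leq_trans jN).
move: h1 h2 h3 h4 h5; rewrite /eta !ler_norml; lra.
Unshelve. all: by end_near. Qed.

End sequence.

Lemma edge_theta_continuous : {within `[0, 1]%classic, continuous edge_theta}.
Proof.
have [s [s0 s1 sf sm]] := seed_cross_threshold a0 R far paths.
have [k [r [f kP]]] := block_sequence.
apply/subspace_continuousP => p; rewrite /= in_itv/= => /andP[p0 p1].
have [ps|sp] := leP p s.
  exact: (@edge_theta_continuous_sub k r f kP s s0 s1 sf p p0 ps).
exact: (@edge_theta_continuous_super k r f kP s s0 sm p sp p1).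
Qed.

End deterministic.

(** * Local events in the limit *)

Section local_events.
Variables (R : realType) (Q : egraph -> Prop) (n : nat).
Hypothesis Qn : forall g h, ball_iso n g h -> Q g -> Q h.

Let U : set (bsgraph R) := [set x | Q (repr x)].

Lemma local_near (x : bsgraph R) : \forall y \near x, Q (repr x) <-> Q (repr y).
Proof.
apply/nbhs_ballP; exists n.+1%:R^-1 => /=; first by rewrite invr_gt0.
move=> y; rewrite /ball/= => /root_dist_lt[m mP].
rewrite ltf_pV2 ?posrE// ltr_nat ltnS => nm.
have xy := ball_iso_le (ltnW nm) mP.
by split; apply: Qn => //; exact: ball_iso_sym.
Qed.

Lemma local_continuous : continuous (\1_U : bsgraph R -> R).
Proof.
move=> x; apply: (@cvg_near_cst _ _ _ _ (nbhs x)).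
apply: (@filterS _ (nbhs x) _ _ _ _ (local_near x)) => y xy.
by rewrite !indicE; congr (_ %:R); congr nat_of_bool; apply/idP/idP;
  rewrite !inE /U/= => /xy.
Qed.

Lemma local_measurable : measurable U.
Proof.
apply: sub_sigma_algebra; rewrite /= openE => x Ux.
apply: (@filterS _ (nbhs x) _ _ _ _ (local_near x)) => y xy.
exact/xy.
Qed.

Lemma local_pi (g : egraph) : (\pi_(bsgraph R) g)%qT \in U = `[< Q g >].
Proof.
have gi := egraph_iso_ball n (repr_iso R g).
apply/idP/asboolP; rewrite inE /U/=; apply: Qn => //; exact: ball_iso_sym.
Qed.

(** A property of a ball around the root has a continuous indicator. *)
Lemma bs_limit_local (G1 : ograph) d (T : measurableType d)
    (P : probability T R) (X : {mfun T >-> bsgraph R}) (b : R) :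
  is_bs_limit G1 P X ->
  (\forall k \near \oo, b <= root_mean (hierarchical G1 k) (\1_U : bsgraph R -> R)) ->
  (b%:E <= P (X @^-1` U))%E.
Proof.
move=> limX bk.
have bounded_U : bounded_fun (\1_U : bsgraph R -> R).
  exists 1; split => // M M1 x _ /=; rewrite indicE.
  by rewrite ger0_norm// (le_trans _ (ltW M1))// lern1 leq_b1.
have := limX _ local_continuous bounded_U.
have -> : (\1_U : bsgraph R -> R) \o X = \1_(X @^-1` U).
  by apply/funext => w; rewrite /= !indicE; congr (_ %:R); congr nat_of_bool;
    apply/idP/idP; rewrite !inE.
rewrite expectation_indic; last exact: measurable_funPTI local_measurable.
move=> cU; rewrite -(cvg_lim _ cU)//; apply: lime_ge.
  by apply/cvg_ex; eexists; exact: cU.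
by apply: filterS bk => k; rewrite lee_fin.
Qed.

End local_events.

Section almost_surely.
Variables (G1 : ograph) (a0 : arcs G1) (R : realType).
Hypothesis far : ~~ uadj G1 osrc osnk.
Local Notation A := (arcs G1).
Local Notation hier := (hierarchical G1).

Lemma sheltered_block_local L N g h : ball_iso #|hier L.*2|.+1 g h ->
  sheltered_block a0 L N g -> sheltered_block a0 L N h.
Proof.
move=> gh [r [f [rL Nr /edge_block_ball_iso/(_ gh)[f' fB]]]].
by exists r, f'.
Qed.

Let m : R := #|{: A}|%:R.

Let m_gt0 : 0 < m.
Proof. by rewrite ltr0n; apply/card_gt0P; exists a0. Qed.

Let rate : R := 1 - (2 * m ^+ 2)^-1.

(** A uniform arc of the (L.*2 + k)-th graph has uniform innermost digits, and these
  give the position in its block of level L.*2. *)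
Lemma root_mean_sheltered L N k :
  1 - 2 ^+ N * rate ^+ L <= root_mean (hier (L.*2 + k))
    (\1_[set x : bsgraph R | sheltered_block a0 L N (repr x)]).
Proof.
pose bad (r : seq A) := (shelters (rev r) < N)%N.
rewrite /root_mean (card_arcs_hier a0 far) (sum_arcs_hier a0 far).
rewrite [leRHS]mulrC ler_pdivlMr; last by rewrite natrX exprn_gt0.
apply: (@le_trans _ _ (wsum (L.*2 + k) (fun r : seq A => 1 - (bad (take L.*2 r))%:R))).
  rewrite wsumB wsum_cst (@wsum_take G1 R L.*2 k (fun r => (bad r)%:R)) -mulr_natr.
  rewrite mulrBl !mul1r !natrX -/m lerD2l lerN2 -[leLHS]mulr_natr natrX -/m.
  have := shelters_count R far L N; rewrite -/m => /(ler_wpM2r (exprn_ge0 k (ltW m_gt0))) h.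
  apply: le_trans h _; rewrite exprD mulrA ler_wpM2r ?exprn_ge0 ?(ltW m_gt0)//.
  rewrite -mulrA ler_wpM2l ?exprn_ge0// -muln2 mulnC exprM -exprMn.
  rewrite (_ : m ^+ 2 - 2^-1 = rate * m ^+ 2)// /rate mulrBl mul1r invfM mulfVK//.
  by rewrite expf_neq0// gt_eqF.
apply: ler_wsum => r rk; rewrite /= indicE (local_pi R (@sheltered_block_local L N)).
case: (boolP (bad _)) => [_|]; first by rewrite subrr.
rewrite subr0 -leqNgt => Nr; have [f fB] := edge_block_hier a0 rk.
rewrite (_ : `[< _ >] = true)//; apply/asboolP; exists (take L.*2 r), f; split => //.
by rewrite size_takel// rk leq_addr.
Qed.

Lemma rate_lt1 : `|rate| < 1.
Proof.
have m1 : 1 <= m by rewrite -[leLHS]/(1%:R) ler_nat; apply/card_gt0P; exists a0.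
have m2 : 1 <= m ^+ 2 by rewrite exprn_ege1.
have : 0 < (2 * m ^+ 2)^-1 <= 1.
  rewrite invr_gt0 mulr_gt0 ?exprn_gt0//= invf_le1; last by rewrite mulr_gt0// exprn_gt0.
  by rewrite -[leLHS]mulr1 ler_pM// ler1n.
rewrite /rate ltr_norml => /andP[? ?]; apply/andP; split; lra.
Qed.

Lemma almost_surely_sheltered d (T : measurableType d)
    (P : probability T R) (X : {mfun T >-> bsgraph R}) : is_bs_limit G1 P X ->
  {ae P, forall w, forall N, exists L, sheltered_block a0 L N (repr (X w))}.
Proof.
move=> limX.
pose D L N := X @^-1` [set x : bsgraph R | sheltered_block a0 L N (repr x)].
have mD L N : measurable (D L N).
  apply: measurable_funPTI; exact: local_measurable (@sheltered_block_local L N).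
have PD L N : ((1 - 2 ^+ N * rate ^+ L)%:E <= P (D L N))%E.
  apply: (bs_limit_local (@sheltered_block_local L N) limX).
  by exists L.*2 => // k /= /subnKC <-; exact: root_mean_sheltered.
have PDC L N : (P (~` D L N) <= (2 ^+ N * rate ^+ L)%:E)%E.
  rewrite probability_setC// -(@fineK _ (P (D L N))) ?fin_num_measure//.
  have := PD L N; rewrite -(@fineK _ (P (D L N))) ?fin_num_measure// lee_fin -EFinB lee_fin.
  lra.
apply: (@negligibleS _ _ _ _ (\bigcup_N \bigcap_L ~` D L N)).
  move=> w /= /existsNP[N /forallNP NL]; exists N => // L _; exact: NL.
apply: negligible_bigcup => N; apply/negligibleP.
  by apply: bigcapT_measurable => L; exact: measurableC.
apply/eqP; rewrite eq_le measure_ge0 andbT; apply/lee_addgt0Pr => e e0; rewrite add0e.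
have : (2 ^+ N * rate ^+ L) @[L --> \oo] --> (0 : R).
  by rewrite -[X in _ --> X](mulr0 (2 ^+ N)); apply: cvgMr; exact: cvg_expr rate_lt1.
move=> h; have [L _ /(_ L (leqnn L)) LP] := @cvgr_lt _ _ _ _ _ _ h e e0.
apply: (@le_trans _ _ (P (~` D L N))).
  apply: le_measure; rewrite ?inE; [|exact: measurableC|by move=> w; exact].
  by apply: bigcapT_measurable => L'; exact: measurableC.
by apply: le_trans (PDC L N) _; rewrite lee_fin ltW.
Qed.

End almost_surely.

Theorem theorem6p6 (R : realType) (G1 : ograph)
    (dist_gt1 : (1 < graph_dist (uadj G1) osrc osnk)%N)
    (paths : two_edge_disjoint_paths (uadj G1) osrc osnk)
    (d : measure_display) (T : measurableType d) (P : probability T R)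
    (X : {mfun T >-> bsgraph R}) (limX : is_bs_limit G1 P X) :
  {ae P, forall w, {within `[0, 1]%classic, continuous (theta (X w))}}.
Proof.
have far : ~~ uadj G1 osrc osnk.
  apply: contraTN dist_gt1 => st; rewrite -leqNgt.
  have w1 : is_walk (uadj G1) osrc osnk [:: osnk] by rewrite /is_walk/= st eqxx.
  by apply/graph_dist_le; [exists [:: osnk]|exists [:: osnk]].
have [a0 _] := arc_at (osrc_neq_osnk G1).
apply: filterS (almost_surely_sheltered a0 far limX) => w wB.
exact: (edge_theta_continuous far paths wB).
Qed.
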